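(* Let $K$ be a field and let $V$ be a symplectic $K$-vector space of genus $n\ge 1$. There is a resolution (exact sequence) of $\mathbb Z[\mathrm{Sp}(V)]$-modules $$0\to\mathrm{St}(V)\to\bigoplus_{g(W)=n-1}\mathrm{St}(W)\otimes\mathrm{St}^\omega(W^\perp)\to\cdots\to\bigoplus_{g(W)=1}\mathrm{St}(W)\otimes\mathrm{St}^\omega(W^\perp)\to\mathrm{St}^\omega(V)\to0,$$ where the direct sums are taken over symplectic subspaces $W\subset V$ and $g(W)$ denotes the genus of $W$.
   Context: A symplectic $K$-vector space is a finite-dimensional vector space with a nondegenerate alternating bilinear form $\omega$; its genus is half its dimension, and $\mathrm{Sp}(V)\cong\mathrm{Sp}_{2n}(K)$ is its group of form-preserving automorphisms. A subspace $W\subset V$ is symplectic if $\omega|_W$ is nondegenerate; then $V=W\oplus W^\perp$ with $W^\perp$ symplectic. Tensor products are over $\mathbb Z$. For a $K$-vector space $U$ of dimension $N$, the Tits building $\mathbb T(U)$ is the simplicial complex whose simplices are flags of proper nonzero subspaces of $U$, and $\mathrm{St}(U)=\widetilde H_{N-2}(\mathbb T(U);\mathbb Z)$. For a symplectic space $U$ of genus $m$, $\mathbb T^\omega(U)$ is the simplicial complex whose simplices are flags of nonzero isotropic subspaces of $U$ (subspaces on which $\omega$ vanishes), and $\mathrm{St}^\omega(U)=\widetilde H_{m-1}(\mathbb T^\omega(U);\mathbb Z)$. Elements of $\mathrm{Sp}(V)$ permute the summands and act by the induced maps. *)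

(* Defs.v *)
From HB Require Import structures.
From mathcomp Require Import all_boot all_algebra.
From mathcomp Require Import sesquilinear ring_quotient boolp.
From mathcomp.multinomials Require Import freeg.

Set Implicit Arguments.
Unset Strict Implicit.
Unset Printing Implicit Defensive.

Import GRing.Theory.
Local Open Scope ring_scope.
Local Open Scope quotient_scope.

(* Z[G]-modules, as abelian groups with an additive left action of G; their   *)
(* homomorphisms are the equivariant additive maps.                           *)
HB.mixin Record isGModule (G : groupType) M of GRing.Zmodule M := {
  gact : G -> M -> M;
  gactD : forall g, {morph gact g : x y / x + y};
  gact1 : forall x, gact 1%g x = x;
  gactM : forall g h x, gact (g * h)%g x = gact g (gact h x)
}.

#[short(type="gmodType")]
HB.structure Definition GModule (G : groupType) :=
  {M of isGModule G M & GRing.Zmodule M}.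

Definition equivariant (G : groupType) (M N : gmodType G) (f : M -> N) : Prop :=
  forall (g : G) x, f (gact g x) = gact g (f x).

Definition exact_at (A B C : zmodType) (f : A -> B) (g : B -> C) : Prop :=
  forall y, g y = 0 <-> exists x, f x = y.

Section FreegLift.
Variables (K L : choiceType).

Lemma freeg_ext (M : zmodType) (f g : {additive {freeg K / int} -> M}) :
  (forall x, f << x >> = g << x >>) -> f =1 g.
Proof.
move=> fg D; rewrite -(freeg_sumE D) !raddf_sum; apply: eq_bigr => x _.
have -> : << coeff x D *g x >> = << x >> *~ coeff x D :> {freeg K / int}.
  by rewrite freegU_mulz intz.
by rewrite !raddfMz fg.
Qed.

HB.instance Definition _ (f : K -> {freeg L / int}) :=
  GRing.isZmodMorphism.Build _ _ (fglift f) (lift_is_additive f).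

Lemma fgliftU (f : K -> {freeg L / int}) x : fglift f << x >> = f x.
Proof. by rewrite liftU scale1r. Qed.

End FreegLift.

Section QuotientMap.
Variables (A B : zmodType) (I : zmodClosed A) (J : zmodClosed B) (f : A -> B).

Definition qmap (x : {ideal_quot I}) : {ideal_quot J} := \pi_{ideal_quot J} (f (repr x)).

Hypotheses (fB : {morph f : x y / x - y}) (fIJ : forall x, x \in I -> f x \in J).

Lemma qmap_pi x : qmap (\pi_{ideal_quot I} x) = \pi_{ideal_quot J} (f x).
Proof.
apply/eqP; rewrite -Quotient.idealrBE -fB; apply: fIJ.
by rewrite Quotient.idealrBE reprK.
Qed.

Lemma qmapD : {morph qmap : x y / x + y}.
Proof.
move=> x y; rewrite -[x]reprK -[y]reprK -raddfD /= !qmap_pi -raddfD /=.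
have f0 : f 0 = 0 by rewrite -(subrr 0) fB subrr.
have fN u : f (- u) = - f u by rewrite -sub0r fB f0 sub0r.
by rewrite -[u in f (_ + u)]opprK fB fN opprK.
Qed.

End QuotientMap.
Arguments qmap {A B I} J f x.

Section OrderedChains.
Variable T : choiceType.
Implicit Types (s : seq T) (X : pred (seq T)) (p : nat).

Definition face s (i : nat) : seq T := take i s ++ drop i.+1 s.

Definition bd : {freeg (seq T) / int} -> {freeg (seq T) / int} :=
  fglift (fun s => \sum_(i < size s) << (-1) ^+ i *g face s i >>).
HB.instance Definition _ := GRing.Additive.on bd.

(* A complex is given by the predicate X selecting, among sequences of        *)
(* vertices, its simplices (including the empty one), each listed in its      *)
(* canonical order. `chain X p` is the group of simplicial chains on the      *)
(* simplices with p vertices, i.e. of dimension p - 1; for p = 0 this is the  *)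
(* target Z of the augmentation.                                              *)
Definition chain X p : pred {freeg (seq T) / int} :=
  fun c => all (fun s => X s && (size s == p)) (dom c).

Definition cycle_pred X p : pred {freeg (seq T) / int} :=
  fun c => chain X p c && (bd c == 0).

Lemma chainP X p c :
  reflect (forall s, coeff s c != 0 -> X s && (size s == p)) (chain X p c).
Proof.
by apply: (iffP allP) => h s hs; apply: h; rewrite ?mem_dom // -mem_dom.
Qed.

Lemma chain_zmod_closed X p : zmod_closed (chain X p).
Proof.
split=> [|c d /chainP hc /chainP hd]; apply/chainP=> s; first by rewrite coeff0 eqxx.
rewrite coeffB; case: (coeff s c =P 0) => [->|/eqP/hc //].
by rewrite sub0r oppr_eq0 => /hd.
Qed.
HB.instance Definition _ X p := GRing.isZmodClosed.Build _ (chain X p) (chain_zmod_closed X p).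

Lemma cycle_zmod_closed X p : zmod_closed (cycle_pred X p).
Proof.
have [h0 hB] := chain_zmod_closed X p.
split=> [|c d /andP[hc /eqP c0] /andP[hd /eqP d0]]; apply/andP; split.
- exact: h0.
- by rewrite raddf0.
- exact: hB.
- by rewrite raddfB /= c0 d0 subr0.
Qed.
HB.instance Definition _ X p :=
  GRing.isZmodClosed.Build _ (cycle_pred X p) (cycle_zmod_closed X p).

Record cycles X p := Cycle {cycle_val :> {freeg (seq T) / int}; _ : cycle_pred X p cycle_val}.
HB.instance Definition _ X p := [isSub for @cycle_val X p].
HB.instance Definition _ X p := [Choice of cycles X p by <:].
HB.instance Definition _ X p := [SubChoice_isSubZmodule of cycles X p by <:].

Definition boundary X p : pred (cycles X p) :=
  fun z => `[< exists2 b, chain X p.+1 b & bd b = val z >].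

Lemma boundary_zmod_closed X p : zmod_closed (@boundary X p).
Proof.
have [h0 hB] := chain_zmod_closed X p.+1.
split=> [|z w /asboolP[b hb bz] /asboolP[c hc cw]]; apply/asboolP.
  by exists 0; rewrite ?raddf0 //; exact: h0.
exists (b - c); first exact: hB.
by rewrite !raddfB /= bz cw.
Qed.
HB.instance Definition _ X p :=
  GRing.isZmodClosed.Build _ (@boundary X p) (@boundary_zmod_closed X p).

(* `rhom X p` is the reduced homology group of degree p - 1 *)
Definition boundaries X p : zmodClosed (cycles X p) :=
  GRing.ZmodClosed.clone (cycles X p) (@boundary X p) _.

Definition rhom X p : Type := {ideal_quot boundaries X p}.
HB.instance Definition _ X p := GRing.Zmodule.on (rhom X p).

Lemma rhom_pi_surj X p (x : rhom X p) : exists z : cycles X p, x = \pi_(rhom X p) z.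
Proof. by exists (repr x); rewrite reprK. Qed.

End OrderedChains.

Arguments bd {T} _.

Section InducedMaps.
Definition push (T1 T2 : choiceType) (phi : T1 -> T2) :
    {freeg (seq T1) / int} -> {freeg (seq T2) / int} :=
  fglift (fun s => << map phi s >>).
HB.instance Definition _ (T1 T2 : choiceType) (phi : T1 -> T2) :=
  GRing.Additive.on (push phi).

Variables (T T' : choiceType) (phi : T -> T').

Lemma face_map (s : seq T) i : face (map phi s) i = map phi (face s i).
Proof. by rewrite /face map_cat map_take map_drop. Qed.

Lemma bd_push c : bd (push phi c) = push phi (bd c).
Proof.
apply: (freeg_ext (f := bd \o push phi) (g := push phi \o bd)) => s /=.
rewrite /push /bd !fgliftU raddf_sum size_map; apply: eq_bigr => i _ /=.
have U (K : choiceType) k (x : K) : << k *g x >> = << x >> *~ k :> {freeg K / int}.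
  by rewrite freegU_mulz intz.
by rewrite [in RHS]U raddfMz /= fgliftU face_map -U.
Qed.

Lemma chain_push (X : pred (seq T)) (Y : pred (seq T')) p q c :
    p = q -> (forall s, X s -> Y (map phi s)) ->
  chain X p c -> chain Y q (push phi c).
Proof.
move=> <- XY /allP hc; rewrite -(freeg_sumE c) raddf_sum /=.
have [h0 hB] := chain_zmod_closed Y p.
rewrite big_seq; apply: (big_ind (fun c => chain Y p c)) => [|a b ha hb|s /hc/andP[Xs sz]].
- exact: h0.
- by rewrite -[b]opprK; apply: (hB) => //; rewrite -sub0r; apply: hB.
rewrite /push liftU; apply/chainP => t; rewrite coeffZ coeffU mul1r.
by case: (map phi s =P t) => [<- _|_]; rewrite ?mulr0 ?eqxx // XY //= size_map.
Qed.

End InducedMaps.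

Lemma push_id (T : choiceType) (phi : T -> T) c : phi =1 id -> push phi c = c.
Proof.
move=> phi_id; apply: (freeg_ext (f := push phi) (g := idfun)) => s /=.
by rewrite /push fgliftU (eq_map phi_id) map_id.
Qed.

Lemma push_comp (T T' T'' : choiceType) (phi : T -> T') (psi : T' -> T'') c :
  push (psi \o phi) c = push psi (push phi c).
Proof.
apply: (freeg_ext (f := push _) (g := push psi \o push phi)) => s /=.
by rewrite /push !fgliftU map_comp.
Qed.

Section HomologyMaps.

(* The map induced by phi; meaningful when phi carries simplices of X to      *)
(* simplices of Y and p = q (a cycle not sent to a cycle of Y is mapped to 0). *)
Definition cycle_map (T T' : choiceType) (phi : T -> T') (X : pred (seq T))
    (Y : pred (seq T')) p q (z : cycles X p) : cycles Y q :=
  insubd 0 (push phi (val z)).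

Definition rhom_map (T T' : choiceType) (phi : T -> T') (X : pred (seq T))
    (Y : pred (seq T')) p q : rhom X p -> rhom Y q :=
  qmap (boundaries Y q) (@cycle_map T T' phi X Y p q).

Variables (T T' : choiceType) (phi : T -> T') (X : pred (seq T)) (Y : pred (seq T')).
Variables p q : nat.
Hypotheses (pq : p = q) (XY : forall s, X s -> Y (map phi s)).

Lemma val_cycle_map (z : cycles X p) : val (cycle_map phi Y q z) = push phi (val z).
Proof.
rewrite val_insubd; case: ifP => // /negbT/negP nYc; case: nYc.
case: z => c /= /andP[hc /eqP c0].
apply/andP; split; first exact: chain_push pq XY hc.
by rewrite bd_push c0 raddf0.
Qed.

Lemma cycle_mapB : {morph cycle_map phi (X := X) Y (p := p) q : x y / x - y}.
Proof. by move=> x y; apply: val_inj; rewrite raddfB /= !val_cycle_map raddfB. Qed.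

Lemma cycle_map_boundary z : z \in @boundary T X p -> cycle_map phi Y q z \in @boundary T' Y q.
Proof.
move=> /asboolP[b hb bz]; apply/asboolP; exists (push phi b); first exact: chain_push (congr1 S pq) XY hb.
by rewrite bd_push bz val_cycle_map.
Qed.

Lemma rhom_map_pi z : rhom_map phi Y q (\pi_(rhom X p) z) = \pi_(rhom Y q) (cycle_map phi Y q z).
Proof. by apply: qmap_pi; [exact: cycle_mapB | exact: cycle_map_boundary]. Qed.

Lemma rhom_mapD : {morph rhom_map phi (X := X) Y (p := p) q : x y / x + y}.
Proof. by apply: qmapD; [exact: cycle_mapB | exact: cycle_map_boundary]. Qed.

End HomologyMaps.

Lemma rhom_map_id (T : choiceType) (phi : T -> T) (X : pred (seq T)) p (x : rhom X p) :
  phi =1 id -> rhom_map phi X p x = x.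
Proof.
move=> phi_id; have XX s : X s -> X (map phi s) by rewrite map_id_in.
have [z ->] := rhom_pi_surj x; rewrite rhom_map_pi //.
by congr (\pi_(_) _); apply: val_inj; rewrite val_cycle_map // push_id.
Qed.

Lemma rhom_map_comp (T T' T'' : choiceType) (phi : T -> T') (psi : T' -> T'')
    (X : pred (seq T)) (Y : pred (seq T')) (Z : pred (seq T'')) p q r (x : rhom X p) :
    p = q -> q = r -> (forall s, X s -> Y (map phi s)) -> (forall s, Y s -> Z (map psi s)) ->
  rhom_map (psi \o phi) Z r x = rhom_map psi Z r (rhom_map phi Y q x).
Proof.
move=> pq qr XY YZ; have pr := etrans pq qr.
have XZ s : X s -> Z (map (psi \o phi) s).
  by move=> Xs; rewrite map_comp; apply/YZ/XY.
have [z ->] := rhom_pi_surj x; rewrite !rhom_map_pi //.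
by congr (\pi_(_) _); apply: val_inj; rewrite !val_cycle_map // push_comp.
Qed.

Section Tensor.

(* the subgroup generated by the bilinearity relations *)
Inductive bilin_rel (A B : zmodType) : {freeg (A * B)%type / int} -> Prop :=
| BilinRel0 : bilin_rel 0
| BilinRelB x y of bilin_rel x & bilin_rel y : bilin_rel (x - y)
| BilinRelL a a' b : bilin_rel (<< (a + a', b) >> - << (a, b) >> - << (a', b) >>)
| BilinRelR a b b' : bilin_rel (<< (a, b + b') >> - << (a, b) >> - << (a, b') >>).

Definition bilin_relb (A B : zmodType) : pred {freeg (A * B)%type / int} :=
  fun x => `[< bilin_rel x >].

Lemma bilin_rel_zmod_closed (A B : zmodType) : zmod_closed (@bilin_relb A B).
Proof.
split=> [|x y /asboolP hx /asboolP hy]; apply/asboolP; first exact: BilinRel0.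
exact: BilinRelB.
Qed.
HB.instance Definition _ (A B : zmodType) :=
  GRing.isZmodClosed.Build _ (@bilin_relb A B) (@bilin_rel_zmod_closed A B).

Definition bilin_relations (A B : zmodType) : zmodClosed {freeg (A * B)%type / int} :=
  GRing.ZmodClosed.clone {freeg (A * B)%type / int} (@bilin_relb A B) _.

(* tensor product over Z *)
Definition tensor (A B : zmodType) : Type :=
  {ideal_quot bilin_relations A B}.
HB.instance Definition _ (A B : zmodType) := GRing.Zmodule.on (tensor A B).

Lemma tensor_pi_surj (A B : zmodType) (x : tensor A B) :
  exists z : {freeg (A * B)%type / int}, x = \pi_(tensor A B) z.
Proof. by exists (repr x); rewrite reprK. Qed.

Definition tensor_pre (A B A' B' : zmodType) (f : A -> A') (g : B -> B') :
    {freeg (A * B)%type / int} -> {freeg (A' * B')%type / int} :=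
  fglift (fun ab => << (f ab.1, g ab.2) >>).
HB.instance Definition _ (A B A' B' : zmodType) (f : A -> A') (g : B -> B') :=
  GRing.Additive.on (tensor_pre f g).

Lemma tensor_preU (A B A' B' : zmodType) (f : A -> A') (g : B -> B') a b :
  tensor_pre f g << (a, b) >> = << (f a, g b) >>.
Proof. exact: fgliftU. Qed.

(* f (x) g, for additive f and g *)
Definition tensor_map (A B A' B' : zmodType) (f : A -> A') (g : B -> B') :
    tensor A B -> tensor A' B' :=
  qmap (bilin_relations A' B') (tensor_pre f g).

Variables (A B A' B' : zmodType) (f : A -> A') (g : B -> B').
Hypotheses (fD : {morph f : x y / x + y}) (gD : {morph g : x y / x + y}).

Lemma tensor_pre_rel x : x \in @bilin_relb A B -> tensor_pre f g x \in @bilin_relb A' B'.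
Proof.
move=> /asboolP hx; apply/asboolP; elim: hx => [|y z _ hy _ hz|a a' b|a b b'].
- by rewrite raddf0; exact: BilinRel0.
- by rewrite raddfB; exact: BilinRelB.
- by rewrite !raddfB /= !tensor_preU fD; exact: BilinRelL.
- by rewrite !raddfB /= !tensor_preU gD; exact: BilinRelR.
Qed.

Lemma tensor_map_pi z : tensor_map f g (\pi_(tensor A B) z) = \pi_(tensor A' B') (tensor_pre f g z).
Proof. by apply: qmap_pi; [exact: raddfB | exact: tensor_pre_rel]. Qed.

Lemma tensor_mapD : {morph tensor_map f g : x y / x + y}.
Proof. by apply: qmapD; [exact: raddfB | exact: tensor_pre_rel]. Qed.

End Tensor.

Lemma tensor_map_id (A B : zmodType) (f : A -> A) (g : B -> B) (x : tensor A B) :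
  f =1 id -> g =1 id -> tensor_map f g x = x.
Proof.
move=> fid gid; have [z ->] := tensor_pi_surj x.
rewrite tensor_map_pi; do ?[by move=> a b; rewrite ?fid ?gid].
congr (\pi_(_) _); apply: (freeg_ext (f := tensor_pre f g) (g := idfun)) => -[a b] /=.
by rewrite tensor_preU fid gid.
Qed.

Lemma tensor_map_comp (A B A' B' A'' B'' : zmodType)
    (f1 : A -> A') (g1 : B -> B') (f2 : A' -> A'') (g2 : B' -> B'')
    (f : A -> A'') (g : B -> B'') (x : tensor A B) :
    {morph f1 : x y / x + y} -> {morph g1 : x y / x + y} ->
    {morph f2 : x y / x + y} -> {morph g2 : x y / x + y} ->
    f =1 f2 \o f1 -> g =1 g2 \o g1 ->
  tensor_map f g x = tensor_map f2 g2 (tensor_map f1 g1 x).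
Proof.
move=> f1D g1D f2D g2D ef eg.
have fD : {morph f : x y / x + y} by move=> a b; rewrite !ef /= f1D f2D.
have gD : {morph g : x y / x + y} by move=> a b; rewrite !eg /= g1D g2D.
have [z ->] := tensor_pi_surj x; rewrite !tensor_map_pi //.
congr (\pi_(_) _).
apply: (freeg_ext (f := tensor_pre f g) (g := tensor_pre f2 g2 \o tensor_pre f1 g1)).
by move=> -[a b] /=; rewrite /tensor_pre !fgliftU /= ef eg.
Qed.

Section DirectSum.
Variables (I : choiceType) (M : I -> zmodType).

Definition finitely_supported (f : forall i, M i) : bool :=
  `[< exists s : seq I, forall i, i \notin s -> f i = 0 >].

Record dsum := DSum {dsum_fun :> forall i, M i; _ : finitely_supported dsum_fun}.
HB.instance Definition _ := [isSub for dsum_fun].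
HB.instance Definition _ := [Choice of dsum by <:].

Lemma dsumP (f g : dsum) : (forall i, f i = g i) -> f = g.
Proof. by move=> fg; apply/val_inj/functional_extensionality_dep. Qed.

Lemma dsum_support (f : dsum) : exists s : seq I, forall i, i \notin s -> f i = 0.
Proof. by case: f => f /= /asboolP. Qed.

Lemma dsum0_subproof : finitely_supported (fun i => 0).
Proof. by apply/asboolP; exists [::]. Qed.
Definition dsum0 := DSum dsum0_subproof.

Lemma dsumN_subproof (f : dsum) : finitely_supported (fun i => - f i).
Proof.
by apply/asboolP; have [s hs] := dsum_support f; exists s => i /hs->; rewrite oppr0.
Qed.
Definition dsumN f := DSum (dsumN_subproof f).

Lemma dsumD_subproof (f g : dsum) : finitely_supported (fun i => f i + g i).
Proof.
apply/asboolP; have [s hs] := dsum_support f; have [t ht] := dsum_support g.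
by exists (s ++ t) => i; rewrite mem_cat negb_or => /andP[/hs-> /ht->]; rewrite addr0.
Qed.
Definition dsumD f g := DSum (dsumD_subproof f g).

Lemma dsumA : associative dsumD.
Proof. by move=> f g h; apply: dsumP => i /=; rewrite addrA. Qed.
Lemma dsumC : commutative dsumD.
Proof. by move=> f g; apply: dsumP => i /=; rewrite addrC. Qed.
Lemma dsum0D : left_id dsum0 dsumD.
Proof. by move=> f; apply: dsumP => i /=; rewrite add0r. Qed.
Lemma dsumND : left_inverse dsum0 dsumN dsumD.
Proof. by move=> f; apply: dsumP => i /=; rewrite addNr. Qed.
HB.instance Definition _ := GRing.isZmodule.Build dsum dsumA dsumC dsum0D dsumND.

End DirectSum.


(* `{skew_symmetric V}` is the structure on which the library defines orthov   *)
(* and nondegenerate. A symplectic form is required in addition to satisfy    *)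
(* omega u u = 0, which implies skew-symmetry in every characteristic.        *)
Section Symplectic.
Variables (K : fieldType) (V : vectType K) (omega : {skew_symmetric V}).
Implicit Types (U W : {vspace V}) (s : seq {vspace V}).

Definition proper_subv U W := (U <= W)%VS && (U != W).

(* Simplices of T(W), as strictly increasing sequences: flags of proper nonzero subspaces of W. *)
Definition tits W : pred (seq {vspace V}) := fun s =>
  sorted proper_subv s && all (fun U => (U != 0%VS) && proper_subv U W) s.

Definition isotropic U := (U <= orthov omega U)%VS.

(* Simplices of T^omega(W): flags of nonzero isotropic subspaces of W. *)
Definition iso_tits W : pred (seq {vspace V}) := fun s =>
  sorted proper_subv s &&
  all (fun U => [&& U != 0%VS, (U <= W)%VS & isotropic U]) s.

Definition genus W := (\dim W)./2.

(* the restriction of omega to W has radical W :&: W^perp *)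
Definition is_symplectic_subspace W := (W :&: orthov omega W == 0)%VS.

(* Reduced homology in degrees \dim W - 2 and genus W - 1: the index of rhom  *)
(* exceeds the degree by one.                                                 *)
Definition St W := rhom (tits W) (\dim W).-1.
Definition Stw W := rhom (iso_tits W) (genus W).
HB.instance Definition _ W := GRing.Zmodule.on (St W).
HB.instance Definition _ W := GRing.Zmodule.on (Stw W).

Definition is_Sp (g : 'End(V)) : bool := (lker g == 0%VS) && `[< isometry omega omega g >].

Record Sp := MkSp {sp_lfun :> 'End(V); _ : is_Sp sp_lfun}.
HB.instance Definition _ := [isSub for sp_lfun].
HB.instance Definition _ := [Choice of Sp by <:].

Lemma Sp_lker0 (g : Sp) : lker g == 0%VS.
Proof. by case: g => g /= /andP[]. Qed.

Lemma Sp_isometry (g : Sp) u v : omega (g u) (g v) = omega u v.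
Proof. by case: g => g /= /andP[_ /asboolP]; apply. Qed.

Lemma Sp1_subproof : is_Sp \1%VF.
Proof.
apply/andP; split; first by apply/lker0P => u v; rewrite !id_lfunE.
by apply/asboolP => u v; rewrite !id_lfunE.
Qed.

Lemma SpM_subproof (g h : Sp) : is_Sp (g \o h)%VF.
Proof.
apply/andP; split; last by apply/asboolP => u v; rewrite !comp_lfunE !Sp_isometry.
apply/lker0P => u v; rewrite !comp_lfunE.
by move/(lker0P (Sp_lker0 g))/(lker0P (Sp_lker0 h)).
Qed.

Lemma SpV_subproof (g : Sp) : is_Sp (g^-1)%VF.
Proof.
apply/andP; split.
  by apply/lker0P; apply: can_inj (lker0_lfunVK (Sp_lker0 g)).
by apply/asboolP => u v; rewrite -(Sp_isometry g) !lker0_lfunVK ?Sp_lker0.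
Qed.

Definition Sp1 := MkSp Sp1_subproof.
Definition SpM g h := MkSp (SpM_subproof g h).
Definition SpV g := MkSp (SpV_subproof g).

Lemma SpMA : associative SpM.
Proof. by move=> f g h; apply: val_inj; rewrite /= comp_lfunA. Qed.
Lemma Sp1M : left_id Sp1 SpM.
Proof. by move=> g; apply: val_inj; rewrite /= comp_lfun1l. Qed.
Lemma SpM1 : right_id Sp1 SpM.
Proof. by move=> g; apply: val_inj; rewrite /= comp_lfun1r. Qed.
Lemma SpVM : left_inverse Sp1 SpV SpM.
Proof. by move=> g; apply: val_inj; rewrite /= lker0_compVf // Sp_lker0. Qed.
Lemma SpMV : right_inverse Sp1 SpV SpM.
Proof. by move=> g; apply: val_inj; rewrite /= lker0_compfV // Sp_lker0. Qed.
HB.instance Definition _ := isGroup.Build Sp SpMA Sp1M SpM1 SpVM SpMV.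

Definition vact (g : Sp) U : {vspace V} := (g @: U)%VS.

Lemma vact1 U : vact 1%g U = U.
Proof. exact: lim1g. Qed.

Lemma vactM (g h : Sp) U : vact (g * h)%g U = vact g (vact h U).
Proof. exact: limg_comp. Qed.

Lemma vactK (g : Sp) U : vact g^-1%g (vact g U) = U.
Proof. by rewrite -vactM mulVg vact1. Qed.

Lemma vactVK (g : Sp) U : vact g (vact g^-1%g U) = U.
Proof. by rewrite -vactM mulgV vact1. Qed.

Lemma vactS (g : Sp) U W : (vact g U <= vact g W)%VS = (U <= W)%VS.
Proof.
apply/idP/idP; last exact: limgS.
by move=> /(limgS (g^-1)%g); rewrite -!/(vact _ _) !vactK.
Qed.

Lemma vact_inj (g : Sp) : injective (vact g).
Proof. exact: can_inj (vactK g). Qed.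

Lemma vact_proper (g : Sp) U W : proper_subv (vact g U) (vact g W) = proper_subv U W.
Proof. by rewrite /proper_subv vactS (inj_eq (@vact_inj g)). Qed.

Lemma vact0 (g : Sp) : vact g 0%VS = 0%VS.
Proof. exact: limg0. Qed.

Lemma vactf (g : Sp) : vact g fullv = fullv.
Proof. exact/lker0_limgf/Sp_lker0. Qed.

Lemma vact_eq0 (g : Sp) U : (vact g U == 0%VS) = (U == 0%VS).
Proof. by rewrite -{1}(vact0 g) (inj_eq (@vact_inj g)). Qed.

Lemma dim_vact (g : Sp) U : \dim (vact g U) = \dim U.
Proof. by apply: limg_dim_eq; rewrite (eqP (Sp_lker0 g)) capv0. Qed.

Lemma vact_orthov (g : Sp) U : vact g (orthov omega U) = orthov omega (vact g U).
Proof.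
have le (h : Sp) W : (vact h (orthov omega W) <= orthov omega (vact h W))%VS.
  apply/subvP => _ /memv_imgP[u /mem_orthovP uW ->].
  by apply/mem_orthovP => _ /memv_imgP[w wW ->]; rewrite Sp_isometry uW.
apply/eqP; rewrite eqEsubv le /= -(vactS g^-1%g) vactK.
by apply: subv_trans (le _ _) _; rewrite vactK.
Qed.

Lemma vact_cap (g : Sp) U W : vact g (U :&: W)%VS = (vact g U :&: vact g W)%VS.
Proof. exact/lker0_img_cap/Sp_lker0. Qed.

Lemma vact_isotropic (g : Sp) U : isotropic (vact g U) = isotropic U.
Proof. by rewrite /isotropic -vact_orthov vactS. Qed.

Lemma vact_symplectic (g : Sp) W :
  is_symplectic_subspace (vact g W) = is_symplectic_subspace W.
Proof. by rewrite /is_symplectic_subspace -vact_orthov -vact_cap vact_eq0. Qed.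

Lemma tits_vact (g : Sp) W s : tits W s -> tits (vact g W) (map (vact g) s).
Proof.
rewrite /tits (mono_sorted (@vact_proper g)) all_map => /andP[-> /=].
by apply: sub_all => U /=; rewrite vact_eq0 vact_proper.
Qed.

Lemma iso_tits_vact (g : Sp) W s : iso_tits W s -> iso_tits (vact g W) (map (vact g) s).
Proof.
rewrite /iso_tits (mono_sorted (@vact_proper g)) all_map => /andP[-> /=].
by apply: sub_all => U /=; rewrite vact_eq0 vactS vact_isotropic.
Qed.

(* Total in W', but meaningful only for W' = g W. *)
Definition St_map (g : Sp) W W' : St W -> St W' := rhom_map (vact g) (tits W') _.
Definition Stw_map (g : Sp) W W' : Stw W -> Stw W' := rhom_map (vact g) (iso_tits W') _.
Arguments St_map g {W} W' x.
Arguments Stw_map g {W} W' x.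

Lemma St_mapD (g : Sp) W W' : vact g W = W' -> {morph @St_map g W W' : x y / x + y}.
Proof.
by move=> <-; apply: rhom_mapD; [rewrite dim_vact | exact: tits_vact].
Qed.

Lemma Stw_mapD (g : Sp) W W' : vact g W = W' -> {morph @Stw_map g W W' : x y / x + y}.
Proof.
by move=> <-; apply: rhom_mapD; [rewrite /genus dim_vact | exact: iso_tits_vact].
Qed.

Lemma St_map1 W (x : St W) : St_map 1%g W x = x.
Proof. by apply: rhom_map_id; exact: vact1. Qed.

Lemma Stw_map1 W (x : Stw W) : Stw_map 1%g W x = x.
Proof. by apply: rhom_map_id; exact: vact1. Qed.

Lemma St_mapM (g h : Sp) W W' W'' (x : St W) : vact h W = W' -> vact g W' = W'' ->
  St_map (g * h)%g W'' x = St_map g W'' (St_map h W' x).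
Proof.
move=> <- <-; rewrite /St_map.
have -> : vact (g * h)%g = vact g \o vact h by apply/funext; exact: vactM.
by apply: rhom_map_comp; rewrite ?dim_vact //; exact: tits_vact.
Qed.

Lemma Stw_mapM (g h : Sp) W W' W'' (x : Stw W) : vact h W = W' -> vact g W' = W'' ->
  Stw_map (g * h)%g W'' x = Stw_map g W'' (Stw_map h W' x).
Proof.
move=> <- <-; rewrite /Stw_map.
have -> : vact (g * h)%g = vact g \o vact h by apply/funext; exact: vactM.
by apply: rhom_map_comp; rewrite /genus ?dim_vact //; exact: iso_tits_vact.
Qed.

Definition StV := St fullv.
HB.instance Definition _ := GRing.Zmodule.on StV.
HB.instance Definition _ := isGModule.Build Sp StV
  (fun g => @St_mapD g fullv fullv (vactf g)) (@St_map1 fullv)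
  (fun g h x => St_mapM x (vactf h) (vactf g)).

Definition StwV := Stw fullv.
HB.instance Definition _ := GRing.Zmodule.on StwV.
HB.instance Definition _ := isGModule.Build Sp StwV
  (fun g => @Stw_mapD g fullv fullv (vactf g)) (@Stw_map1 fullv)
  (fun g h x => Stw_mapM x (vactf h) (vactf g)).

Section Sum.
Variable k : nat.

Definition is_symp_genus W := is_symplectic_subspace W && (genus W == k).

Record symp_subspace := SympSubspace {symp_val :> {vspace V}; _ : is_symp_genus symp_val}.
HB.instance Definition _ := [isSub for symp_val].
HB.instance Definition _ := [Choice of symp_subspace by <:].
Implicit Types w : symp_subspace.

Lemma symp_act_subproof (g : Sp) w : is_symp_genus (vact g w).
Proof. by rewrite /is_symp_genus vact_symplectic /genus dim_vact; case: w. Qed.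

Definition symp_act (g : Sp) w : symp_subspace := SympSubspace (symp_act_subproof g w).

Lemma symp_act1 w : symp_act 1%g w = w.
Proof. by apply: val_inj; exact: vact1. Qed.
Lemma symp_actM g h w : symp_act (g * h)%g w = symp_act g (symp_act h w).
Proof. by apply: val_inj; exact: vactM. Qed.
Lemma symp_actVK g w : symp_act g (symp_act g^-1%g w) = w.
Proof. by apply: val_inj; exact: vactVK. Qed.
Lemma symp_actK g w : symp_act g^-1%g (symp_act g w) = w.
Proof. by apply: val_inj; exact: vactK. Qed.

Definition summand w : zmodType := tensor (St w) (Stw (orthov omega w)).

Definition StSum := dsum summand.
HB.instance Definition _ := GRing.Zmodule.on StSum.

Definition summand_map (g : Sp) w w' : summand w -> summand w' :=
  tensor_map (@St_map g w w') (@Stw_map g (orthov omega w) (orthov omega w')).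
Arguments summand_map g {w} w' x.

Lemma summand_mapD (g : Sp) w w' :
  symp_act g w = w' -> {morph @summand_map g w w' : x y / x + y}.
Proof.
move=> <-; apply: tensor_mapD; first exact: St_mapD.
by apply: Stw_mapD; exact: vact_orthov.
Qed.

Lemma summand_map1 w (x : summand w) : summand_map 1%g w x = x.
Proof. by apply: tensor_map_id => y; [exact: St_map1 | exact: Stw_map1]. Qed.

Lemma summand_mapM (g h : Sp) w w' w'' (x : summand w) :
    symp_act h w = w' -> symp_act g w' = w'' ->
  summand_map (g * h)%g w'' x = summand_map g w'' (summand_map h w' x).
Proof.
move=> <- <-; apply: tensor_map_comp.
- exact: St_mapD.
- by apply: Stw_mapD; exact: vact_orthov.
- exact: St_mapD.
- by apply: Stw_mapD; exact: vact_orthov.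
- by move=> y; exact: St_mapM.
- by move=> y; apply: Stw_mapM; exact: vact_orthov.
Qed.

Lemma sum_act_subproof (g : Sp) (f : StSum) :
  finitely_supported (fun w => summand_map g w (f (symp_act g^-1%g w))).
Proof.
apply/asboolP; have [s hs] := dsum_support f.
exists (map (symp_act g) s) => w ws; rewrite hs; last first.
  by apply: contra ws => /(map_f (symp_act g)); rewrite symp_actVK.
have := summand_mapD (symp_actVK g w) 0 0.
by rewrite addr0 -[LHS]addr0 => /addrI <-.
Qed.

(* g maps the W-summand to the gW-summand *)
Definition sum_act (g : Sp) (f : StSum) : StSum := DSum (sum_act_subproof g f).

Lemma sum_actD g : {morph sum_act g : f1 f2 / f1 + f2}.
Proof. by move=> f1 f2; apply: dsumP => w; exact: (summand_mapD (symp_actVK g w)). Qed.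

Lemma summand_map_dep (g : Sp) (f : StSum) w w1 w2 :
  w1 = w2 -> summand_map g w (f w1) = summand_map g w (f w2).
Proof. by move=> ->. Qed.

Lemma sum_act1 f : sum_act 1%g f = f.
Proof.
apply: dsumP => w /=.
rewrite (@summand_map_dep _ f w _ w) ?summand_map1 //.
by rewrite invg1 symp_act1.
Qed.

Lemma sum_actM g h f : sum_act (g * h)%g f = sum_act g (sum_act h f).
Proof.
apply: dsumP => w /=; rewrite -summand_mapM ?symp_actVK //.
by apply: summand_map_dep; rewrite invgM symp_actM.
Qed.

HB.instance Definition _ := isGModule.Build Sp StSum sum_actD sum_act1 sum_actM.

End Sum.

(* For V of genus n: the terms of the resolution, numbered from St^omega(V)   *)
(* in position 0 to St(V) in position n.                                      *)
Definition resolution_term (n k : nat) : gmodType Sp :=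
  if k == 0%N then (StwV : gmodType Sp)
  else if k == n then (StV : gmodType Sp)
  else (StSum k : gmodType Sp).

End Symplectic.

(* Main.v *)
Require Import Defs.
From HB Require Import structures.
From mathcomp Require Import all_boot all_algebra.
From mathcomp Require Import sesquilinear ring_quotient boolp.
From mathcomp Require wochoice.
From mathcomp.multinomials Require Import freeg.
From mathcomp Require Import ring zify.

Set Implicit Arguments.
Unset Strict Implicit.
Unset Printing Implicit Defensive.

Import GRing.Theory.
Local Open Scope ring_scope.
Local Open Scope quotient_scope.

(* Write rk U for the rank of omega on a subspace U, and let F_k be the poset of nonzero       *)
(* subspaces of rank at most 2k: F_0 consists of the isotropic subspaces, F_(n-1) of the       *)
(* proper ones, and F_n has the top V. By dimension, the flags of F_k have at most n + k        *)
(* members. The k-th term of the resolution is the group Rel k of top-dimensional chains of     *)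
(* F_k whose boundary lies in F_(k-1), and the differential is the simplicial boundary.         *)
(* Adding a line raises the rank by at most 2, so F_k is null-homotopic in F_(k+1), which is    *)
(* exactness. It remains to identify Rel k with the sum of the St(W) (x) St^omega(W^perp).      *)
(* The map sends x (x) y to the shuffle product of the cone x * W with y; its left inverse      *)
(* reads off the flags passing through W. A relative cycle none of whose flags meets a          *)
(* symplectic subspace of genus k is 0, because below a first vertex U of rank 2k which has a   *)
(* nonzero radical, joining with that radical is a cone. That the tensor product of the groups  *)
(* of cycles is the group of chains which are cycles in both variables needs no knowledge of    *)
(* the buildings: groups of cycles are direct summands, as subgroups of free abelian groups are *)
(* free.                                                                                        *)

(** * Free abelian groups *)

(** All terms are realised in one free abelian group, on finite sequences of subspaces, with [bd] as
    the only differential. [realizes] says that a module is carried bijectively and equivariantly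
    onto [Rel k]. Once this is known for every term ([realizes0], [realizesn], [realizes_sum]),
    differentials and exactness are transported from the groups [Rel k]. There exactness is short:
    for a line L, a cycle in [Rel k] is up to sign the boundary of its shuffle product with L, which
    lies in [Rel k.+1] ([bd_shuffle1], [Rel_exact]). In position n that product would live on flags
    of 2n + 1 nonzero subspaces of a space of dimension 2n, so cycles vanish there
    ([Rel_top_cycle]).

    For the middle terms, dim U is at most n + (rk U) / 2 ([dim_bound]), so a top-dimensional flag
    of F_k has exactly one member in each dimension 1, ..., n + k. If it passes through a symplectic
    W of dimension 2k, every member U above W is the sum of W and the isotropic space U :&: W^perp,
    so the flag amounts to a flag in W together with an isotropic flag in W^perp ([flag_through]).
    [unglue] reads off this pair and [glue] multiplies it back. Ungluing at W' what was glued at W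
    gives the identity for W' = W and 0 otherwise ([unglue_glue]), hence injectivity. For
    surjectivity, subtract from a relative cycle all its glued components: the rest meets no
    symplectic subspace of dimension 2k and is 0 by [Rel_eq0]. That a component is a genuine tensor
    of cycles is [tlift_surj], which rests on the splitting [exists_retraction]. *)

Local Notation "'Z[' K ]" := {freeg K / int} (at level 0, K at level 200).

Section Support.
Variable K : choiceType.
Implicit Types (Q : K -> Prop) (c d : Z[K]).

Definition supp Q c := forall x, coeff x c != 0 -> Q x.

Lemma freegUZ k (x : K) : << k *g x >> = k *: << x >> :> Z[K].
Proof. by apply/eqP/freeg_eqP => y; rewrite coeffZ !coeffU mul1r. Qed.

Lemma freegUz k (x : K) : << k *g x >> = << x >> *~ k :> Z[K].
Proof. by rewrite freegU_mulz intz. Qed.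

Lemma freegZz k c : k *: c = c *~ k.
Proof. by apply/eqP/freeg_eqP => y; rewrite coeffZ raddfMz /= -mulrzl intz. Qed.

Lemma signrZK m c : (-1) ^+ m *: ((-1) ^+ m *: c) = c.
Proof. by rewrite scalerA -exprD addnn -signr_odd odd_double expr0 scale1r. Qed.

Lemma supp0 Q : supp Q 0.
Proof. by move=> x; rewrite coeff0 eqxx. Qed.

Lemma suppD Q c d : supp Q c -> supp Q d -> supp Q (c + d).
Proof.
move=> hc hd x; rewrite coeffD; case: (coeff x c =P 0) => [->|/eqP/hc //].
by rewrite add0r => /hd.
Qed.

Lemma suppN Q c : supp Q c -> supp Q (- c).
Proof. by move=> hc x; rewrite coeffN oppr_eq0 => /hc. Qed.

Lemma suppB Q c d : supp Q c -> supp Q d -> supp Q (c - d).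
Proof. by move=> hc hd; apply: suppD => //; exact: suppN. Qed.

Lemma suppZ Q k c : supp Q c -> supp Q (k *: c).
Proof. by move=> hc x; rewrite coeffZ mulf_eq0 negb_or => /andP[_ /hc]. Qed.

Lemma supp_sum Q (I : Type) (r : seq I) (P : pred I) (F : I -> Z[K]) :
  (forall i, P i -> supp Q (F i)) -> supp Q (\sum_(i <- r | P i) F i).
Proof. by move=> h; apply: (big_ind (supp Q)) => //; [exact: supp0 | exact: suppD]. Qed.

Lemma suppU Q x : Q x -> supp Q << x >>.
Proof. by move=> Qx y; rewrite coeffU mul1r; case: (x =P y) => [<-|_]; rewrite ?eqxx. Qed.

Lemma suppW Q Q' c : (forall x, Q x -> Q' x) -> supp Q c -> supp Q' c.
Proof. by move=> h hc x /hc/h. Qed.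

Lemma supp_False c : supp (fun=> False) c -> c = 0.
Proof.
move=> h; apply/eqP/freeg_eqP => x; rewrite coeff0.
by case: (coeff x c =P 0) => // /eqP/h.
Qed.

Lemma suppP c : supp (fun x => x \in dom c) c.
Proof. by move=> x; rewrite -mem_dom. Qed.

Lemma freeg_ext_in (M : zmodType) (f g : {additive Z[K] -> M}) Q c :
  (forall x, Q x -> f << x >> = g << x >>) -> supp Q c -> f c = g c.
Proof.
move=> fg hc; rewrite -(freeg_sumE c) !raddf_sum !big_seq; apply: eq_bigr => x.
by rewrite mem_dom freegUz !raddfMz /= => /hc/fg->.
Qed.

End Support.

Lemma supp_raddf (K L : choiceType) (f : {additive Z[K] -> Z[L]}) (Q : K -> Prop) (Q' : L -> Prop) c :
  (forall x, Q x -> supp Q' (f << x >>)) -> supp Q c -> supp Q' (f c).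
Proof.
move=> fg hc y; rewrite -(freeg_sumE c) raddf_sum raddf_sum /= => h.
suff: has (fun x => coeff y (f << coeff x c *g x >>) != 0) (dom c).
  case/hasP=> x; rewrite mem_dom freegUz raddfMz /= => /hc Qx.
  by rewrite raddfMz /= mulrz_eq0 negb_or => /andP[_]; exact: fg.
apply: contraNT h => /hasPn h; rewrite big_seq big1 // => x /h.
by rewrite negbK => /eqP.
Qed.

Lemma raddf_freegZ (K L : choiceType) (f : {additive Z[K] -> Z[L]}) k c : f (k *: c) = k *: f c.
Proof. by rewrite !freegZz raddfMz. Qed.

Section Bilinear.
Variables K L M : choiceType.
Variable f : K -> L -> Z[M].

Definition bilift (c : Z[K]) (d : Z[L]) : Z[M] := fglift (fun x => fglift (f x) d) c.

End Bilinear.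

(** The definition is visibly additive only in the first argument; exchanging the two finite sums
    gives additivity in the second. *)
Lemma bilift_swap (K L M : choiceType) (f : K -> L -> Z[M]) c d :
  bilift f c d = bilift (fun y x => f x y) d c.
Proof.
have E (N : choiceType) (g : N -> Z[M]) e : fglift g e = \sum_(x <- dom e) g x *~ coeff x e.
  rewrite -[in LHS](freeg_sumE e) raddf_sum; apply: eq_bigr => x _.
  by rewrite freegUz raddfMz /= fgliftU.
rewrite /bilift !E; under eq_bigr do rewrite E mulrz_suml.
rewrite exchange_big; apply: eq_bigr => y _; rewrite E mulrz_suml; apply: eq_bigr => x _.
by rewrite -!mulrzA mulrC.
Qed.

Section BilinearAdditive.
Variables K L M : choiceType.
Implicit Types f : K -> L -> Z[M].

HB.instance Definition _ f (c : Z[K]) :=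
  GRing.isZmodMorphism.Build _ _ (bilift f c)
    (fun d1 d2 => etrans (bilift_swap f c (d1 - d2))
      (etrans (raddfB (fglift _) d1 d2)
        (congr2 (fun a b => a - b) (esym (bilift_swap f c d1)) (esym (bilift_swap f c d2))))).

Definition biliftl f (d : Z[L]) (c : Z[K]) := bilift f c d.
HB.instance Definition _ f (d : Z[L]) :=
  GRing.isZmodMorphism.Build _ _ (biliftl f d)
    (fun c1 c2 => raddfB (fglift (fun x => fglift (f x) d)) c1 c2).

Lemma biliftU f x y : bilift f << x >> << y >> = f x y.
Proof. by rewrite /bilift !fgliftU. Qed.

Lemma biliftUl f x d : bilift f << x >> d = fglift (f x) d.
Proof. by rewrite /bilift !fgliftU. Qed.

Lemma biliftDl f c1 c2 d : bilift f (c1 + c2) d = bilift f c1 d + bilift f c2 d.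
Proof. exact: (raddfD (biliftl f d)). Qed.

Lemma bilift0l f d : bilift f 0 d = 0.
Proof. exact: (raddf0 (biliftl f d)). Qed.

Lemma biliftNl f c d : bilift f (- c) d = - bilift f c d.
Proof. exact: (raddfN (biliftl f d)). Qed.

Lemma biliftZl f k c d : bilift f (k *: c) d = k *: bilift f c d.
Proof. exact: (raddf_freegZ (biliftl f d)). Qed.

Lemma biliftZr f k c d : bilift f c (k *: d) = k *: bilift f c d.
Proof. exact: raddf_freegZ. Qed.

Lemma supp_bilift f (Q : K -> Prop) (Q' : L -> Prop) (Q'' : M -> Prop) c d :
    (forall x y, Q x -> Q' y -> supp Q'' (f x y)) ->
  supp Q c -> supp Q' d -> supp Q'' (bilift f c d).
Proof.
move=> h hc hd; apply: (supp_raddf (f := biliftl f d)) hc => x Qx.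
rewrite /= /biliftl biliftUl; apply: (supp_raddf (f := fglift (f x))) hd => y Qy.
by rewrite /= fgliftU; exact: h.
Qed.

End BilinearAdditive.

(** * Kernels of maps between free abelian groups split off *)

Section Retraction.
Import wochoice.
Variables S T : choiceType.
Variable f : {additive Z[S] -> Z[T]}.

Section WellOrdered.
Variable R : rel T.
Hypotheses (R_total : total R) (R_anti : antisymmetric R) (R_trans : transitive R).
Hypothesis R_min : forall A : {pred T}, nonempty A -> exists m, minimum_of R A m.

Let below t c := supp (fun x => R x t) (c : Z[T]).

Lemma exists_leading (c : Z[T]) : c != 0 -> exists m, coeff m c != 0 /\ below m c.
Proof.
move=> c0; suff: exists m, m \in dom c /\ {in dom c, forall x, R x m}.
  by case=> m []; rewrite mem_dom => hm h; exists m; split=> // x; rewrite -mem_dom => /h.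
have: dom c != [::] by rewrite dom_eq0.
elim: (dom c) => // x s IH _; have [->|/IH[m [ms hm]]] := eqVneq s [::].
  by exists x; split=> [|y]; rewrite inE // => /eqP->; have := R_total x x; rewrite orbb.
have [xm|mx] := orP (R_total x m).
  by exists m; split=> [|y]; rewrite inE ?ms ?orbT // => /predU1P[->|/hm].
exists x; split=> [|y]; first exact: mem_head.
by rewrite inE => /predU1P[->|/hm ym]; [have := R_total x x; rewrite orbb | apply: R_trans ym mx].
Qed.

(** The coefficients at t of the elements of the image of f bounded by t form an ideal of the
    integers, and e realises a generator, found by division with remainder. *)
Lemma exists_minimal_coeff t : exists e : Z[S], below t (f e) /\
  forall c, below t (f c) -> (coeff t (f e) %| coeff t (f c))%Z.
Proof.
pose P n := `[< exists c, [/\ below t (f c), (0 < n)%N & `|coeff t (f c)|%N = n] >].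
have [[n Pn]|noP] := pselect (exists n, P n); last first.
  (* Here all these coefficients vanish, and e = 0 generates the zero ideal. *)
  exists 0; rewrite raddf0; split; first exact: supp0.
  move=> c hc; rewrite coeff0 dvd0z -absz_eq0 -leqn0 leqNgt; apply/negP => h; apply: noP.
  by exists `|coeff t (f c)|%N; apply/asboolP; exists c.
case: (@ex_minnP P (ex_intro _ n Pn)) => m /asboolP[e [he m0 em]] m_min.
exists e; split=> // c hc; set a := coeff t (f c); set b := coeff t (f e).
have b0 : b != 0 by rewrite -absz_eq0 em -lt0n.
apply/dvdz_mod0P/eqP; apply: contraT => r0.
pose c' := c - e *~ (a %/ b)%Z.
have ec' : f c' = f c - (a %/ b)%Z *: f e by rewrite raddfB raddfMz freegZz.
have hc' : below t (f c') by rewrite ec'; apply: suppB => //; apply: suppZ.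
have cf : coeff t (f c') = (a %% b)%Z by rewrite ec' coeffB coeffZ.
have /m_min : P `|coeff t (f c')|%N.
  by apply/asboolP; exists c'; split=> //; rewrite cf lt0n absz_eq0.
by rewrite cf leqNgt -em -ltz_nat gez0_abs ?modz_ge0 // ltz_mod.
Qed.

Let e t : Z[S] := sval (cid (exists_minimal_coeff t)).
Let e_below t : below t (f (e t)). Proof. by rewrite /e; case: cid => ? []. Qed.
Let e_dvd t c : below t (f c) -> (coeff t (f (e t)) %| coeff t (f c))%Z.
Proof. by rewrite /e; case: cid => ? [? h] /=; exact: h. Qed.

Let pivotal (a : Z[T]) := supp (fun t => coeff t (f (e t)) != 0) a.

(** The elements [f (e t)] with nonzero pivot have distinct leading terms t, so they are
    independent: the coefficient at the largest t cannot cancel. *)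
Lemma pivotal_inj a : pivotal a -> f (fglift e a) = 0 -> a = 0.
Proof.
move=> ha fa0; apply: contraTeq isT => /exists_leading[m [am below_m]].
have: coeff m (f (fglift e a)) = 0 by rewrite fa0 coeff0.
have -> : a = (a - << coeff m a *g m >>) + << coeff m a *g m >> by rewrite subrK.
set a' := a - _; have ha' : supp (fun t => R t m /\ t != m) a'.
  move=> t; rewrite coeffB coeffU; have [->|tm] := eqVneq t m; first by rewrite mulr1 subrr eqxx.
  by rewrite mulr0 subr0 => /below_m.
have ha2 : supp (fun x => x != m) (f (fglift e a')).
  apply: (supp_raddf (f := f \o fglift e)) ha' => t [tm ntm] /=; rewrite fgliftU => x /e_below xt.
  by apply: contraNneq ntm => xm; apply/eqP/R_anti; rewrite tm -xm xt.
have hm0 : coeff m (f (fglift e a')) = 0.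
  by apply/eqP; apply: contraT => /ha2; rewrite eqxx.
rewrite (raddfD (fglift e)) (raddfD f) (raddfD (coeff m)) /= hm0 add0r.
rewrite freegUz !raddfMz /= fgliftU => /eqP.
by rewrite mulrz_eq0 (negbTE am) (negbTE (ha _ am)).
Qed.

(** They also span the image: at the least bound t of a counterexample, subtracting the right
    multiple of [f (e t)] lowers the leading term. *)
Lemma pivotal_surj c : exists2 a, pivotal a & f c = f (fglift e a).
Proof.
pose ok c := exists2 a, pivotal a & f c = f (fglift e a).
have ok0 c' : f c' = 0 -> ok c' by move=> fc0; exists 0; [exact: supp0 | rewrite fc0 !raddf0].
pose A : {pred T} := fun t => `[< exists c, below t (f c) /\ ~ ok c >].
have noA : ~ nonempty A.
  case/R_min=> t [/asboolP[c' [hc' nok]] min_t]; apply: nok.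
  set q := (coeff t (f c') %/ coeff t (f (e t)))%Z; pose c2 := c' - e t *~ q.
  have ec2 : f c2 = f c' - q *: f (e t) by rewrite raddfB raddfMz freegZz.
  have bc2 : below t (f c2) by rewrite ec2; apply: suppB => //; apply: suppZ; exact: e_below.
  have cc2 : coeff t (f c2) = 0.
    by rewrite ec2 coeffB coeffZ -[coeff t (f c')](divzK (e_dvd hc')) subrr.
  have [a ha ea] : ok c2.
    have [/ok0//|/exists_leading[m [mc2 bm]]] := eqVneq (f c2) 0.
    have [//|nok] := pselect (ok c2).
    have /min_t tm : m \in A by apply/asboolP; exists c2.
    have mt : m = t by apply: R_anti; rewrite tm (bc2 _ mc2).
    by rewrite mt cc2 eqxx in mc2.
  exists (a + << q *g t >>).
    apply: suppD => // x; rewrite coeffU; have [<-|_] := eqVneq t x; last by rewrite mulr0 eqxx.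
    by rewrite mulr1; apply: contraNneq => e0; rewrite /q e0 divz0.
  by rewrite freegUz !raddfD /= raddfMz /= fgliftU -ea ec2 raddfMz freegZz subrK.
have [/ok0//|/exists_leading[m [_ bm]]] := eqVneq (f c) 0.
by apply: contrapT => nok; apply: noA; exists m; apply/asboolP; exists c.
Qed.

Lemma retraction_well_ordered : exists r : Z[S] -> Z[S],
  [/\ {morph r : x y / x - y}, forall c, f (r c) = 0 & forall z, f z = 0 -> r z = z].
Proof.
have uniq_a c a b : pivotal a -> pivotal b -> f c = f (fglift e a) -> f c = f (fglift e b) -> a = b.
  move=> ha hb -> ab; apply/eqP; rewrite -subr_eq0; apply/eqP/pivotal_inj; first exact: suppB.
  by rewrite !raddfB /= ab subrr.
pose a c := s2val (cid2 (pivotal_surj c)).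
have aP c : pivotal (a c) /\ f c = f (fglift e (a c)) by rewrite /a; case: cid2.
exists (fun c => c - fglift e (a c)); split=> [x y|c|z fz].
- have pxy : pivotal (a x - a y) by apply: suppB; apply: (proj1 (aP _)).
  have fxy : f (x - y) = f (fglift e (a x - a y)).
    by rewrite (raddfB (fglift e)) !(raddfB f) -(proj2 (aP x)) -(proj2 (aP y)).
  rewrite (uniq_a _ _ _ (proj1 (aP (x - y))) pxy (proj2 (aP (x - y))) fxy).
  by rewrite (raddfB (fglift e)) !opprD !opprK addrACA.
- by rewrite raddfB /= -(proj2 (aP c)) subrr.
have -> : a z = 0 by apply: pivotal_inj; [exact: (proj1 (aP z)) | rewrite -(proj2 (aP z))].
by rewrite raddf0 subr0.
Qed.

End WellOrdered.

(* The image of f is free, being a subgroup of a free abelian group, so the kernel splits off. *)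
Lemma exists_retraction : exists r : Z[S] -> Z[S],
  [/\ {morph r : x y / x - y}, forall c, f (r c) = 0 & forall z, f z = 0 -> r z = z].
Proof.
have [R Rwo] := well_ordering_principle T.
have R_chain : wo_chain R predT by exact: withinW.
have R_total : total R by move=> x y; exact: (wo_chainW R_chain).
have R_anti : antisymmetric R by move=> x y; exact: (wo_chain_antisymmetric R_chain).
have R_min (A : {pred T}) : nonempty A -> exists m, minimum_of R A m.
  by case/Rwo=> m [hm _]; exists m.
apply: (@retraction_well_ordered R) => // y x z xy yz.
(* Transitivity is read off the minimum of the set of the three elements. *)
have [|m [mA mP]] := R_min [pred u in [:: x; y; z]]; first by exists x; rewrite !inE eqxx.
have hx : R m x by apply: mP; rewrite !inE eqxx.
have hy : R m y by apply: mP; rewrite !inE eqxx orbT.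
have hz : R m z by apply: mP; rewrite !inE eqxx !orbT.
move: mA; rewrite !inE; case/or3P=> /eqP em; subst m => //.
- by rewrite (R_anti x y) // xy hx.
- by rewrite -(R_anti y z) // yz hy.
Qed.

End Retraction.

(** * Top cycles and their tensor products *)

Lemma freeg_ind (K : choiceType) (P : Z[K] -> Prop) :
  P 0 -> (forall c d, P c -> P d -> P (c - d)) -> (forall x, P << x >>) -> forall c, P c.
Proof.
move=> P0 PB PU c; have PN d : P d -> P (- d) by rewrite -sub0r; exact: PB.
have PD d e : P d -> P e -> P (d + e) by move=> hd he; rewrite -[e]opprK; apply/PB/PN.
rewrite -(freeg_sumE c); apply: (big_ind P) => // x _; rewrite freegUz.
have Pn n : P (<< x >> *+ n) by elim: n => // n IH; rewrite mulrS; exact: PD.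
by case: (coeff x c) => n; [exact: Pn | rewrite NegzE mulrNz; exact/PN/Pn].
Qed.

Section TopHomology.
Variables (T : choiceType) (X : pred (seq T)) (p : nat).
Hypothesis X_top : forall s, X s -> size s != p.+1.

(** With no simplices on p + 1 vertices there are no boundaries, so a homology class contains a
    single cycle and [repr] returns it. *)
Definition top_cycle (x : rhom X p) : Z[seq T] := val (repr x).

Lemma top_cycle_pi (z : cycles X p) : top_cycle (\pi_(rhom X p) z) = val z.
Proof.
apply/eqP; rewrite -subr_eq0; apply/eqP.
have: repr (\pi_(rhom X p) z) - z \in boundaries X p by rewrite Quotient.idealrBE reprK.
case/asboolP => b hb; rewrite raddfB /top_cycle => <-; suff -> : b = 0 by rewrite raddf0.
apply: supp_False => s hs; move/chainP: hb => /(_ s hs)/andP[Xs /eqP sz].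
by move: (X_top Xs); rewrite sz eqxx.
Qed.

Lemma top_cycle_cycle x : cycle_pred X p (top_cycle x).
Proof. exact: (valP (repr x)). Qed.

Lemma top_cycleB : {morph top_cycle : x y / x - y}.
Proof.
move=> x y; have [z ->] := rhom_pi_surj x; have [w ->] := rhom_pi_surj y.
by rewrite -raddfB !top_cycle_pi raddfB.
Qed.

Lemma top_cycle_inj : injective top_cycle.
Proof.
move=> x y; have [z ->] := rhom_pi_surj x; have [w ->] := rhom_pi_surj y.
by rewrite !top_cycle_pi => /val_inj ->.
Qed.

Lemma top_cycle_surj c : cycle_pred X p c -> exists x, top_cycle x = c.
Proof. by move=> hc; exists (\pi_(rhom X p) (Cycle hc)); rewrite top_cycle_pi. Qed.

(** [rho] discards all sequences which are not simplices of the right size. The retraction r lands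
    in the kernel of [bd \o rho], so [rho] after r lands in the cycles and fixes them. *)
Lemma top_cycle_proj : exists pr : Z[seq T] -> rhom X p, {morph pr : x y / x - y} /\ cancel top_cycle pr.
Proof.
pose rho : Z[seq T] -> Z[seq T] := fglift (fun s => if X s && (size s == p) then << s >> else 0).
have rho_chain c : chain X p (rho c).
  apply/chainP; apply: (supp_raddf (f := fglift _) (Q := fun=> True)) => // s _ /=.
  by rewrite fgliftU; case: ifP => h; [exact: suppU | exact: supp0].
have [r [rB fr rf]] := exists_retraction (bd \o fglift
  (fun s => if X s && (size s == p) then << s >> else 0)).
have rho_cycle c : cycle_pred X p (rho (r c)) by rewrite /cycle_pred rho_chain; apply/eqP/fr.
exists (fun c => \pi_(rhom X p) (Cycle (rho_cycle c))); split=> [c d|x].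
  by rewrite -raddfB; congr (\pi_(_) _); apply: val_inj; rewrite raddfB /= rB /rho raddfB.
apply: top_cycle_inj; rewrite top_cycle_pi /=; have /andP[hc /eqP c0] := top_cycle_cycle x.
have rho_id : rho (top_cycle x) = top_cycle x.
  move/chainP: hc; apply: (freeg_ext_in (f := fglift _) (g := idfun)) => s h /=.
  by rewrite fgliftU h.
by rewrite rf //= -/rho rho_id.
Qed.

End TopHomology.

(** * The tensor product of two groups of top cycles as chains on pairs *)

Section TensorTop.
Variables (T T' : choiceType) (X : pred (seq T)) (Y : pred (seq T')) (p q : nat).
Hypothesis X_top : forall s, X s -> size s != p.+1.
Hypothesis Y_top : forall s, Y s -> size s != q.+1.
Let A : zmodType := rhom X p.
Let B : zmodType := rhom Y q.

Definition tens (a : A) (b : B) : tensor A B := \pi_(tensor A B) << (a, b) >>.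

Lemma tensDl a a' b : tens (a + a') b = tens a b + tens a' b.
Proof.
apply/eqP; rewrite /tens -raddfD -Quotient.idealrBE opprD addrA.
by apply/asboolP; exact: BilinRelL.
Qed.

Lemma tensDr a b b' : tens a (b + b') = tens a b + tens a b'.
Proof.
apply/eqP; rewrite /tens -raddfD -Quotient.idealrBE opprD addrA.
by apply/asboolP; exact: BilinRelR.
Qed.

Lemma tensBl b : {morph tens^~ b : a a' / a - a'}.
Proof. by move=> a a'; apply: (addIr (tens a' b)); rewrite -tensDl !subrK. Qed.

Lemma tensBr a : {morph tens a : b b' / b - b'}.
Proof. by move=> b b'; apply: (addIr (tens a b')); rewrite -tensDr !subrK. Qed.

Lemma tensor_ind (P : tensor A B -> Prop) :
  P 0 -> (forall x y, P x -> P y -> P (x - y)) -> (forall a b, P (tens a b)) -> forall x, P x.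
Proof.
move=> P0 PB PU x; have [z ->] := tensor_pi_surj x.
apply: (freeg_ind (P := fun z => P (\pi_(tensor A B) z))) z => [|c d|[a b]].
- by rewrite raddf0.
- by rewrite raddfB; exact: PB.
exact: PU.
Qed.

Definition cross : Z[seq T] -> Z[seq T'] -> Z[(seq T * seq T')%type] :=
  bilift (fun s t => << (s, t) >>).

Lemma crossU s t : cross << s >> << t >> = << (s, t) >>.
Proof. exact: biliftU. Qed.

Lemma crossBl d : {morph cross^~ d : c c' / c - c'}.
Proof. exact: (raddfB (biliftl _ d)). Qed.

Lemma crossBr c : {morph cross c : d d' / d - d'}.
Proof. exact: raddfB. Qed.

Lemma coeff_cross c d s t : coeff (s, t) (cross c d) = coeff s c * coeff t d.
Proof.
elim/freeg_ind: c => [|c c' hc hc'|s']; first by rewrite /cross bilift0l !coeff0 mul0r.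
  by rewrite (crossBl d) !coeffB hc hc' mulrBl.
elim/freeg_ind: d => [|d d' hd hd'|t']; first by rewrite /cross raddf0 !coeff0 mulr0.
  by rewrite (crossBr << s' >>) !coeffB hd hd' mulrBr.
by rewrite crossU !coeffU xpair_eqE !mul1r -natrM mulnb.
Qed.

Definition tlift_pre : Z[(A * B)%type] -> Z[(seq T * seq T')%type] :=
  fglift (fun ab => cross (top_cycle ab.1) (top_cycle ab.2)).
HB.instance Definition _ := GRing.Additive.on tlift_pre.

Lemma tlift_preU a b : tlift_pre << (a, b) >> = cross (top_cycle a) (top_cycle b).
Proof. exact: fgliftU. Qed.

Definition tlift (x : tensor A B) := tlift_pre (repr x).

Lemma tlift_pi z : tlift (\pi_(tensor A B) z) = tlift_pre z.
Proof.
apply/eqP; rewrite -subr_eq0 -raddfB; apply/eqP.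
have: repr (\pi_(tensor A B) z) - z \in bilin_relations A B by rewrite Quotient.idealrBE reprK.
move: (_ - z) => u /asboolP; elim=> [|x y _ hx _ hy|a a' b|a b b'].
- exact: raddf0.
- by rewrite raddfB /= hx hy subr0.
- have e : top_cycle a = top_cycle (a + a') - top_cycle a' by rewrite -top_cycleB // addrK.
  by rewrite !raddfB /= !tlift_preU e (crossBl (top_cycle b)) subKr subrr.
- have e : top_cycle b = top_cycle (b + b') - top_cycle b' by rewrite -top_cycleB // addrK.
  by rewrite !raddfB /= !tlift_preU e (crossBr (top_cycle a)) subKr subrr.
Qed.

Lemma tliftB : {morph tlift : x y / x - y}.
Proof.
move=> x y; have [z ->] := tensor_pi_surj x; have [w ->] := tensor_pi_surj y.
by rewrite -raddfB !tlift_pi raddfB.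
Qed.

Lemma tlift_tens a b : tlift (tens a b) = cross (top_cycle a) (top_cycle b).
Proof. by rewrite tlift_pi tlift_preU. Qed.

Definition slicel t : Z[(seq T * seq T')%type] -> Z[seq T] :=
  fglift (fun st => if st.2 == t then << st.1 >> else 0).
HB.instance Definition _ t := GRing.Additive.on (slicel t).

Definition slicer s : Z[(seq T * seq T')%type] -> Z[seq T'] :=
  fglift (fun st => if st.1 == s then << st.2 >> else 0).
HB.instance Definition _ s := GRing.Additive.on (slicer s).

Lemma coeff_slicel s t u : coeff s (slicel t u) = coeff (s, t) u.
Proof.
elim/freeg_ind: u => [|u v hu hv|[s' t']]; first by rewrite raddf0 !coeff0.
  by rewrite raddfB !coeffB hu hv.
by rewrite /slicel fgliftU coeffU xpair_eqE /= andbC; case: eqP => _; rewrite ?coeffU ?coeff0 ?mulr0.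
Qed.

Lemma coeff_slicer s t u : coeff t (slicer s u) = coeff (s, t) u.
Proof.
elim/freeg_ind: u => [|u v hu hv|[s' t']]; first by rewrite raddf0 !coeff0.
  by rewrite raddfB !coeffB hu hv.
by rewrite /slicer fgliftU coeffU xpair_eqE /=; case: eqP => _; rewrite ?coeffU ?coeff0 ?mulr0.
Qed.

Section WithProjections.
Variables (prA : Z[seq T] -> A) (prB : Z[seq T'] -> B).
Hypotheses (prAB : {morph prA : x y / x - y}) (prBB : {morph prB : x y / x - y}).
Hypotheses (liftA : cancel (@top_cycle T X p) prA) (liftB' : cancel (@top_cycle T' Y q) prB).

Let mapU : Z[(seq T * seq T')%type] -> Z[(A * B)%type] :=
  fglift (fun st => << (prA << st.1 >>, prB << st.2 >>) >>).
HB.instance Definition _ := GRing.Additive.on mapU.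

Let mapU_cross c d : \pi_(tensor A B) (mapU (cross c d)) = tens (prA c) (prB d).
Proof.
have pA0 : prA 0 = 0 by have := prAB 0 0; rewrite !subrr.
have pB0 : prB 0 = 0 by have := prBB 0 0; rewrite !subrr.
elim/freeg_ind: c => [|c c' hc hc'|s].
- have t0 : tens 0 (prB d) = 0 by have := tensBl (prB d) 0 0; rewrite /= !subrr.
  by rewrite /cross bilift0l raddf0 pA0 raddf0 t0.
- by rewrite (crossBl d) !raddfB /= hc hc' prAB (tensBl (prB d)).
elim/freeg_ind: d => [|d d' hd hd'|t].
- have t0 : tens (prA << s >>) 0 = 0 by have := tensBr (prA << s >>) 0 0; rewrite !subrr.
  by rewrite /cross !raddf0 pB0 t0.
- by rewrite (crossBr << s >>) !raddfB /= hd hd' prBB (tensBr (prA _)).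
by rewrite crossU /mapU fgliftU.
Qed.

(** The tensor product of the two projections onto cycles is a left inverse. *)
Lemma tlift_inj_proj : injective tlift.
Proof.
apply: (can_inj (g := fun u => \pi_(tensor A B) (mapU u))) => x.
have [z ->] := tensor_pi_surj x; rewrite tlift_pi.
elim/freeg_ind: z => [|z w hz hw|[a b]]; first by rewrite !raddf0.
  by rewrite !raddfB /= hz hw.
by rewrite tlift_preU mapU_cross /= liftA liftB'.
Qed.

(** If all slices of u are cycles, then projecting onto cycles in the first variable fixes u, and so
    does projecting in the second. The composite of the two projections factors through the tensor
    product. *)
Lemma tlift_surj_proj u : (forall t, cycle_pred X p (slicel t u)) ->
  (forall s, cycle_pred Y q (slicer s u)) -> exists x, tlift x = u.
Proof.
move=> hl hr; exists (\pi_(tensor A B) (mapU u)); rewrite tlift_pi.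
pose piA c := top_cycle (prA c); pose piB d := top_cycle (prB d).
have piAB : {morph piA : c d / c - d} by move=> c d; rewrite /piA prAB top_cycleB.
have piBB : {morph piB : c d / c - d} by move=> c d; rewrite /piB prBB top_cycleB.
have piA_id c : cycle_pred X p c -> piA c = c.
  by move=> /(top_cycle_surj X_top)[x <-]; rewrite /piA liftA.
have piB_id d : cycle_pred Y q d -> piB d = d.
  by move=> /(top_cycle_surj Y_top)[x <-]; rewrite /piB liftB'.
have piA0 : piA 0 = 0 by have := piAB 0 0; rewrite !subrr.
have piB0 : piB 0 = 0 by have := piBB 0 0; rewrite !subrr.
pose leftmap := fglift (fun st : seq T * seq T' => cross (piA << st.1 >>) << st.2 >>).
pose rightmap := fglift (fun st : seq T * seq T' => cross << st.1 >> (piB << st.2 >>)).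
have leftmap0 : leftmap 0 = 0 by exact: raddf0.
have leftmapB : {morph leftmap : v w / v - w} by exact: raddfB.
have coeff_left s t v : coeff (s, t) (leftmap v) = coeff s (piA (slicel t v)).
  elim/freeg_ind: v => [|v w hv hw|[s' t']]; first by rewrite leftmap0 coeff0 raddf0 piA0 coeff0.
    by rewrite leftmapB coeffB hv hw raddfB piAB coeffB.
  rewrite /leftmap /slicel !fgliftU coeff_cross coeffU mul1r /=.
  by case: eqP => _; rewrite ?mulr1 // mulr0 piA0 coeff0.
have rightmap0 : rightmap 0 = 0 by exact: raddf0.
have rightmapB : {morph rightmap : v w / v - w} by exact: raddfB.
have coeff_right s t v : coeff (s, t) (rightmap v) = coeff t (piB (slicer s v)).
  elim/freeg_ind: v => [|v w hv hw|[s' t']]; first by rewrite rightmap0 coeff0 raddf0 piB0 coeff0.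
    by rewrite rightmapB coeffB hv hw raddfB piBB coeffB.
  rewrite /rightmap /slicer !fgliftU coeff_cross coeffU mul1r /=.
  by case: eqP => _; rewrite ?mul1r // mul0r piB0 coeff0.
have left_id : leftmap u = u.
  by apply/eqP/freeg_eqP => -[s t]; rewrite coeff_left piA_id // coeff_slicel.
have right_id : rightmap u = u.
  by apply/eqP/freeg_eqP => -[s t]; rewrite coeff_right piB_id // coeff_slicer.
rewrite -[RHS]left_id -[u in RHS]right_id.
apply: (freeg_ext (f := tlift_pre \o mapU) (g := fglift _ \o fglift _)) => -[s t] /=.
rewrite /mapU !fgliftU tlift_preU -/(piA _) -/(piB _).
apply/eqP/freeg_eqP => -[s' t']; rewrite -/leftmap coeff_left coeff_cross.
have -> : slicel t' (cross << s >> (piB << t >>)) = coeff t' (piB << t >>) *: << s >>.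
  by apply/eqP/freeg_eqP => x; rewrite coeff_slicel coeff_cross coeffZ mulrC.
have piAZ k c : piA (k *: c) = k *: piA c.
  have piAN d : piA (- d) = - piA d by rewrite -sub0r piAB piA0 sub0r.
  have piAD d e : piA (d + e) = piA d + piA e by rewrite -[e in LHS]opprK piAB piAN opprK.
  have piAn n d : piA (d *+ n) = piA d *+ n.
    by elim: n => [|n IH]; rewrite ?mulr0n // !mulrS piAD IH.
  by rewrite !freegZz; case: k => n; rewrite ?NegzE ?mulrNz ?piAN -!pmulrn piAn.
by rewrite piAZ coeffZ mulrC.
Qed.

End WithProjections.

Lemma tlift_inj : injective tlift.
Proof.
have [prA [prAB lA]] := top_cycle_proj X_top; have [prB [prBB lB]] := top_cycle_proj Y_top.
exact: tlift_inj_proj prAB prBB lA lB.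
Qed.

Lemma tlift_surj u : (forall t, cycle_pred X p (slicel t u)) ->
  (forall s, cycle_pred Y q (slicer s u)) -> exists x, tlift x = u.
Proof.
have [prA [prAB lA]] := top_cycle_proj X_top; have [prB [prBB lB]] := top_cycle_proj Y_top.
exact: tlift_surj_proj prAB prBB lA lB u.
Qed.

End TensorTop.

(** * Flags and shuffle products *)

Section Faces.
Variable T : choiceType.
Implicit Types (s t : seq T) (c : Z[seq T]).

Lemma bdU s : bd << s >> = \sum_(i < size s) (-1) ^+ i *: << face s i >>.
Proof. by rewrite /bd fgliftU; apply: eq_bigr => i _; rewrite freegUZ. Qed.

Definition rc a : Z[seq T] -> Z[seq T] := fglift (fun s => << rcons s a >>).
HB.instance Definition _ a := GRing.Additive.on (rc a).

(** The sign by number of vertices, as an additive map, so that cone formulas hold for chains of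
    mixed size. *)
Definition eps : Z[seq T] -> Z[seq T] := fglift (fun s => (-1) ^+ size s *: << s >>).
HB.instance Definition _ := GRing.Additive.on eps.

Lemma rcU a s : rc a << s >> = << rcons s a >>. Proof. exact: fgliftU. Qed.
Lemma epsU s : eps << s >> = (-1) ^+ size s *: << s >>. Proof. exact: fgliftU. Qed.

Lemma eps_size n c : supp (fun s => size s = n) c -> eps c = (-1) ^+ n *: c.
Proof.
apply: (freeg_ext_in (f := eps) (g := *:%R ((-1) ^+ n))) => s <- /=.
exact: epsU.
Qed.

Lemma size_face s i : (i < size s)%N -> size (face s i) = (size s).-1.
Proof.
move=> h; rewrite /face size_cat size_take size_drop h.
by rewrite subnS; case: (size s) h => // n h; rewrite subSn //= subnKC.
Qed.

Lemma mem_face s i x : x \in face s i -> x \in s.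
Proof. by rewrite mem_cat => /orP[/mem_take|/mem_drop]. Qed.

Lemma face_rcons s a i : (i < size s)%N -> face (rcons s a) i = rcons (face s i) a.
Proof.
move=> h; rewrite /face -!cats1 take_cat drop_cat h -catA; congr (_ ++ _).
case: (ltngtP i.+1 (size s)) => // [|->]; first by rewrite ltnS leqNgt h.
by rewrite subnn drop0 drop_size.
Qed.

Lemma face_last s a : face (rcons s a) (size s) = s.
Proof. by rewrite /face -cats1 take_size_cat // drop_oversize ?cats0 // size_cat addn1. Qed.

Lemma bd_rcons s a : bd << rcons s a >> = rc a (bd << s >>) + (-1) ^+ size s *: << s >>.
Proof.
rewrite !bdU size_rcons big_ord_recr /= face_last raddf_sum; congr (_ + _).
by apply: eq_bigr => i _; rewrite raddf_freegZ /= rcU face_rcons.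
Qed.

Lemma bd_nil : bd << [::] >> = 0 :> Z[seq T].
Proof. by rewrite bdU big_ord0. Qed.

Lemma bd_rc a c : bd (rc a c) = rc a (bd c) + eps c.
Proof.
apply: (freeg_ext (f := bd \o rc a) (g := (rc a \o bd) \+ eps)) => s /=.
by rewrite rcU bd_rcons epsU.
Qed.

Lemma eps_bd c : eps (bd c) = - bd (eps c).
Proof.
apply: (freeg_ext (f := eps \o bd) (g := \- (bd \o eps))) => s /=.
rewrite epsU raddf_freegZ /= bdU scaler_sumr raddf_sum -sumrN; apply: eq_bigr => i _.
rewrite raddf_freegZ /= epsU size_face // !scalerA -scaleNr; congr (_ *: _).
case: s i => [[]|x s i] //=; rewrite exprS mulN1r mulNr opprK mulrC //.
Qed.

Lemma eps_rc a c : eps (rc a c) = - rc a (eps c).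
Proof.
apply: (freeg_ext (f := eps \o rc a) (g := \- (rc a \o eps))) => s /=.
by rewrite rcU !epsU raddf_freegZ /= rcU size_rcons exprS mulN1r scaleNr.
Qed.

Lemma bd_bd c : bd (bd c) = 0.
Proof.
apply: (freeg_ext (f := bd \o bd) (g := \0)) => s /=.
elim/last_ind: s => [|s a IH]; first by rewrite bd_nil raddf0.
by rewrite bd_rcons raddfD /= bd_rc IH raddf0 add0r raddf_freegZ eps_bd epsU raddf_freegZ addNr.
Qed.

Lemma supp_bd (Q Q' : seq T -> Prop) c :
  (forall s i, Q s -> (i < size s)%N -> Q' (face s i)) -> supp Q c -> supp Q' (bd c).
Proof.
move=> h; apply: (supp_raddf (f := bd)) => s Qs; rewrite /= bdU.
by apply: supp_sum => i _; apply: suppZ; apply: suppU; exact: h.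
Qed.

End Faces.
Arguments eps {T} _.

(** * Flags of subspaces, cones and the Leibniz rule for shuffles *)

Section Shuffle.
Variables (K : fieldType) (V : vectType K).
Notation flagT := (seq {vspace V}).
Implicit Types (s t u x y : flagT) (A B U W : {vspace V}) (c d : Z[flagT]).

Definition flag s := sorted (@proper_subv K V) s.

Lemma proper_subv_trans : transitive (@proper_subv K V).
Proof.
move=> B A C /andP[AB nAB] /andP[BC nBC]; apply/andP; split; first exact: subv_trans BC.
apply: contra nBC => /eqP eAC; rewrite eAC in AB.
by rewrite eqEsubv BC AB.
Qed.

Lemma flag_rcons s A : flag (rcons s A) = flag s && all (@proper_subv K V ^~ A) s.
Proof.
by rewrite /flag !(sorted_pairwise proper_subv_trans) pairwise_rcons andbC.
Qed.

Lemma flag_cat s t : flag (s ++ t) =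
  [&& flag s, flag t & allrel (@proper_subv K V) s t].
Proof.
rewrite /flag !(sorted_pairwise proper_subv_trans) pairwise_cat.
by rewrite andbC andbA.
Qed.

Lemma flag_face s i : flag s -> flag (face s i).
Proof.
move=> hs; apply: (subseq_sorted proper_subv_trans) hs.
rewrite /face -[X in subseq _ X](cat_take_drop i s); apply: cat_subseq; first exact: subseq_refl.
by rewrite -add1n -drop_drop drop_subseq.
Qed.

Definition bflag A s := flag s && all (fun U => U <= A)%VS s.

(** The cone with apex A on top; a flag already containing A would become degenerate and is sent to
    0. *)
Definition app A : Z[flagT] -> Z[flagT] :=
  fglift (fun s => if A \in s then 0 else << rcons s A >>).
HB.instance Definition _ A := GRing.Additive.on (app A).

Lemma appU A s : app A << s >> = if A \in s then 0 else << rcons s A >>.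
Proof. exact: fgliftU. Qed.

Lemma app_rc A c : supp (fun s => A \notin s) c -> app A c = rc A c.
Proof. by apply: freeg_ext_in => s /negbTE As /=; rewrite appU As rcU. Qed.

(* Although app kills the flags containing A, the cone formula holds on all flags bounded by A. *)
Lemma bd_app A c : supp (bflag A) c -> bd (app A c) = app A (bd c) + eps c.
Proof.
move=> hc; apply: (freeg_ext_in (f := bd \o app A) (g := (app A \o bd) \+ eps)) hc => s /andP[fs bs] /=.
rewrite appU epsU; case: ifPn => [As|As]; last first.
  rewrite bd_rcons app_rc //; apply: (supp_bd (Q := fun t => A \notin t)); last exact: suppU.
  by move=> t i At _; apply: contra At; exact: mem_face.
case/lastP: s fs bs As => // s B; rewrite flag_rcons all_rcons => /andP[_ sB] /andP[BA _].
rewrite mem_rcons inE => AsB; have {AsB} eAB : A = B.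
  case/predU1P: AsB => // /(allP sB) /andP[AB nAB]; by apply/eqP; rewrite eqEsubv AB.
subst B; have As : A \notin s.
  by apply/negP => /(allP sB); rewrite /proper_subv eqxx andbF.
rewrite raddf0 bd_rcons raddfD /= [app A (rc _ _)](_ : _ = 0).
  by rewrite add0r raddf_freegZ /= appU (negbTE As) size_rcons exprS mulN1r scaleNr subrr.
apply: (freeg_ext (f := app A \o rc A) (g := \0)) => t /=.
by rewrite rcU appU mem_rcons mem_head.
Qed.

(** The flags are given in reverse order, because the recursion removes the top vertices: every
    chain of the product ends in the sum of the two tops, reached by a last step in one of the two
    flags. *)
Fixpoint rshuffle s : flagT -> Z[flagT] :=
  if s is A :: x then
    fix aux t := if t is B :: y then
      app (A + B)%VS ((-1) ^+ size t *: rshuffle x t + aux y) else << rev s >>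
  else fun t => << rev t >>.

(* The shuffle product of 0 < A_1 < ... < A_p and 0 < B_1 < ... < B_q: the     *)
(* signed sum of the maximal chains of sums A_i + B_j, those with repetitions *)
(* being 0.                                                                   *)
Definition shuffle s t := rshuffle (rev s) (rev t).

Lemma shuffle0s t : shuffle [::] t = << t >>.
Proof. by rewrite /shuffle /= revK. Qed.

Lemma shuffles0 s : shuffle s [::] = << s >>.
Proof. by rewrite /shuffle -[s in RHS]revK; case: (rev s). Qed.

Lemma shuffle_rcons s t A B : shuffle (rcons s A) (rcons t B) =
  app (A + B)%VS ((-1) ^+ (size t).+1 *: shuffle s (rcons t B) + shuffle (rcons s A) t).
Proof.
by rewrite /shuffle !rev_rcons /= size_rev.
Qed.

Lemma flag_last s A U : flag (rcons s A) -> U \in 0%VS :: rcons s A -> (U <= A)%VS.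
Proof.
rewrite flag_rcons => /andP[_ sA]; rewrite inE mem_rcons inE => /or3P[/eqP->|/eqP->|]; rewrite ?sub0v //.
by move/(allP sA)/andP=> [].
Qed.

(** What is used of a flag occurring in a shuffle product; the 0 added to s and t stands for a flag
    not yet entered. *)
Definition shuffled s t u :=
  [/\ flag u, size u = (size s + size t)%N, (0%VS \notin s ++ t -> 0%VS \notin u) &
      forall U, U \in u -> exists A B, [/\ A \in 0%VS :: s, B \in 0%VS :: t & U = (A + B)%VS]].

(** Treats together the two terms of the recursion, before the top A + B is appended. *)
Lemma shuffled_prefix s t A B u :
  shuffled s (rcons t B) u \/ shuffled (rcons s A) t u ->
  [/\ flag u, (size u).+1 = (size (rcons s A) + size (rcons t B))%N,
      (0%VS \notin rcons s A ++ rcons t B -> 0%VS \notin u) &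
      forall U, U \in u -> exists A' B',
        [/\ A' \in 0%VS :: rcons s A, B' \in 0%VS :: rcons t B & U = (A' + B')%VS]].
Proof.
case=> -[fu su u0 uP]; split=> //.
- by rewrite su !size_rcons addSn.
- by move=> h; apply: u0; apply: contra h; rewrite !mem_cat !mem_rcons !inE => /or3P[]->; rewrite ?orbT.
- move=> U /uP[A' [B' [hA hB ->]]]; exists A', B'; split=> //.
  by move: hA; rewrite !inE mem_rcons inE => /orP[]->; rewrite ?orbT.
- by rewrite su !size_rcons addnS.
- by move=> h; apply: u0; apply: contra h; rewrite !mem_cat !mem_rcons !inE => /orP[/orP[]|]->; rewrite ?orbT.
move=> U /uP[A' [B' [hA hB ->]]]; exists A', B'; split=> //.
by move: hB; rewrite !inE mem_rcons inE => /orP[]->; rewrite ?orbT.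
Qed.

Lemma supp_shuffle s t : flag s -> flag t -> supp (shuffled s t) (shuffle s t).
Proof.
elim/last_ind: s t => [|s A IHs] t fs.
  rewrite shuffle0s => ft; apply: suppU; split=> // U Ut.
  by exists 0%VS, U; rewrite !inE eqxx Ut orbT add0v.
elim/last_ind: t => [|t B IHt] ft.
  rewrite shuffles0; apply: suppU; split; rewrite ?addn0 ?cats0 // => U Us.
  by exists U, 0%VS; rewrite inE Us mem_head orbT addv0.
have [fs' ft'] : flag s /\ flag t.
  by move: fs ft; rewrite !flag_rcons => /andP[-> _] /andP[-> _].
rewrite shuffle_rcons.
apply: (supp_raddf (f := app (A + B)%VS)
    (Q := fun u => shuffled s (rcons t B) u \/ shuffled (rcons s A) t u)).
  move=> u /shuffled_prefix[fu su u0 uP] /=; rewrite appU; case: ifPn => [_|ABu]; first exact: supp0.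
  apply: suppU; split; rewrite ?size_rcons ?su ?size_rcons //.
  - rewrite flag_rcons fu; apply/allP => U Uu; apply/andP; split; last first.
      by apply: contraNneq ABu => <-.
    have [A' [B' [hA hB ->]]] := uP _ Uu.
    by apply: addvS; [exact: flag_last fs hA | exact: flag_last ft hB].
  - move=> h; rewrite mem_rcons inE negb_or u0 // andbT eq_sym.
    apply: contraNneq h => AB0; rewrite mem_cat mem_rcons inE.
    by rewrite eq_sym -subv0 -AB0 addvSl.
  move=> U; rewrite mem_rcons inE => /predU1P[->|/uP//].
  by exists A, B; rewrite !inE !mem_rcons !mem_head !orbT.
apply: suppD; [apply: suppZ; apply: suppW (IHs _ fs' ft) | apply: suppW (IHt ft')] => u hu.
  by left.
by right.
Qed.

Lemma shuffled_bflag s t A B u :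
  flag (rcons s A) -> flag (rcons t B) ->
  shuffled s (rcons t B) u \/ shuffled (rcons s A) t u -> bflag (A + B)%VS u.
Proof.
move=> fs ft h.
have [fu _ _ h'] := shuffled_prefix h.
rewrite /bflag fu; apply/allP => U /h'[A' [B' [hA hB ->]]].
by apply: addvS; [exact: flag_last fs hA | exact: flag_last ft hB].
Qed.

Notation P := (bilift shuffle).

Lemma shuffle_rc A B c d :
  P (rc A c) (rc B d) = app (A + B)%VS (P c (eps (rc B d)) + P (rc A c) d).
Proof.
apply: (freeg_ext (f := biliftl shuffle (rc B d) \o rc A)
  (g := app (A + B)%VS \o (biliftl shuffle (eps (rc B d)) \+ (biliftl shuffle d \o rc A)))) => s.
rewrite /= /biliftl !rcU; apply: (freeg_ext (f := P << rcons s A >> \o rc B)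
  (g := app (A + B)%VS \o ((P << s >> \o (eps \o rc B)) \+ P << rcons s A >>))) => t /=.
by rewrite !rcU epsU biliftZr !biliftU shuffle_rcons size_rcons.
Qed.

(** The Leibniz rule, by induction on both flags. By the cone formula [bd_app], faces keeping the
    top A + B reproduce the recursion for faces of s and t keeping A and B; the face without the top
    gives the terms where A or B is deleted. The two products of s with t under the apex cancel. *)
Lemma bd_shuffle s t : flag s -> flag t ->
  bd (shuffle s t) = P (bd << s >>) << t >> + (-1) ^+ size s *: P << s >> (bd << t >>).
Proof.
elim/last_ind: s t => [|s A IHs] t fs.
  move=> _; rewrite bd_nil bilift0l add0r scale1r shuffle0s.
  rewrite biliftUl; apply: esym.
  by apply: (freeg_ext (f := fglift (shuffle [::])) (g := idfun)) => u /=; rewrite fgliftU shuffle0s.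
elim/last_ind: t => [|t B IHt] ft.
  rewrite bd_nil raddf0 scaler0 addr0 shuffles0; apply: esym.
  apply: (freeg_ext (f := biliftl shuffle << [::] >>) (g := idfun)) => u /=.
  by rewrite /biliftl biliftU shuffles0.
have [fs' ft'] : flag s /\ flag t.
  by move: fs ft; rewrite !flag_rcons => /andP[-> _] /andP[-> _].
have h1 := supp_shuffle fs' ft; have h2 := supp_shuffle fs ft'.
rewrite shuffle_rcons bd_app; last first.
  apply: suppD; [apply: suppZ; apply: suppW h1 | apply: suppW h2] => u hu.
    by apply: shuffled_bflag fs ft _; left.
  by apply: shuffled_bflag fs ft _; right.
rewrite [X in _ + X](eps_size (n := (size s + size t).+1)); last first.
  apply: suppD; [apply: suppZ; apply: suppW h1 | apply: suppW h2] => u [_ -> _ _].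
    by rewrite size_rcons addnS.
  by rewrite size_rcons addSn.
have bdZD k (a b : Z[flagT]) : bd (k *: a + b) = k *: bd a + bd b.
  by rewrite raddfD; congr (_ + _); exact: raddf_freegZ.
rewrite bdZD IHs // IHt // size_rcons.
have -> : bd << rcons s A >> = rc A (bd << s >>) + (-1) ^+ size s *: << s >> by exact: bd_rcons.
have eT : eps << rcons t B >> = (-1) ^+ (size t).+1 *: << rcons t B >> by rewrite epsU size_rcons.
have e1 := shuffle_rc A B (bd << s >>) << t >>.
rewrite rcU eT biliftZr in e1.
have e2 := shuffle_rc A B << s >> (bd << t >>).
have e3 : eps (rc B (bd << t >>)) = (-1) ^+ size t *: rc B (bd << t >>).
  by rewrite eps_rc eps_bd (raddfN (rc B)) opprK epsU (raddf_freegZ bd) (raddf_freegZ (rc B)).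
rewrite e3 rcU biliftZr in e2.
have PDr (a b : Z[flagT]) c : P c (a + b) = P c a + P c b by exact: raddfD.
have aD (a b : Z[flagT]) : app (A + B)%VS (a + b) = app (A + B)%VS a + app (A + B)%VS b.
  exact: raddfD.
have aZ k (a : Z[flagT]) : app (A + B)%VS (k *: a) = k *: app (A + B)%VS a.
  exact: raddf_freegZ.
rewrite [bd << rcons t B >>]bd_rcons !biliftDl !biliftZl !PDr !biliftZr e1 e2 !biliftU.
rewrite !(aD, aZ, scalerDr, scalerA).
apply/eqP/freeg_eqP => z; rewrite !(coeffD, coeffZ) !(exprS, exprD).
(* All signs depend only on the parities of the two lengths, which leaves four polynomial
   identities. *)
have sgn n : (-1) ^+ n = 1 :> int \/ (-1) ^+ n = -1 :> int.
  by rewrite -signr_odd; case: (odd n); [right | left].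
by case: (sgn (size s)) => ->; case: (sgn (size t)) => ->; ring.
Qed.

Lemma bd_bilift_shuffle c d : supp flag c -> supp flag d ->
  bd (P c d) = P (bd c) d + P (eps c) (bd d).
Proof.
move=> hc hd; apply: (freeg_ext_in (f := bd \o biliftl shuffle d)
  (g := (biliftl shuffle d \o bd) \+ (biliftl shuffle (bd d) \o eps))) hc => s fs /=.
apply: (freeg_ext_in (f := bd \o P << s >>)
  (g := P (bd << s >>) \+ (P (eps << s >>) \o bd))) hd => t ft /=.
by rewrite biliftU bd_shuffle // epsU biliftZl.
Qed.

(** The boundary of the one-vertex flag R is the empty flag, the unit of the product. So adding R to
    the members of flags contracts every cycle; this is applied to a line and to a radical. *)
Lemma bd_shuffle1 R c : supp flag c -> bd c = 0 -> bd (P c << [:: R] >>) = eps c.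
Proof.
move=> fc c0; rewrite bd_bilift_shuffle ?c0 ?bilift0l ?add0r //; last exact: suppU.
rewrite (bd_rcons [::]) bd_nil raddf0 add0r scale1r.
by apply: (freeg_ext (f := biliftl shuffle << [::] >>) (g := idfun)) => u /=; rewrite /biliftl biliftU shuffles0.
Qed.

Variable g : {vspace V} -> {vspace V}.
Hypotheses (g_inj : injective g) (gD : {morph g : A B / (A + B)%VS}).

Lemma push_app A c : push g (app A c) = app (g A) (push g c).
Proof.
apply: (freeg_ext (f := push g \o app A) (g := app (g A) \o push g)) => s /=.
rewrite appU /push fgliftU appU (mem_map g_inj); case: ifP => _; first by rewrite raddf0.
by rewrite fgliftU map_rcons.
Qed.

Lemma push_shuffle s t : push g (shuffle s t) = shuffle (map g s) (map g t).
Proof.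
elim/last_ind: s t => [|s A IHs] t; first by rewrite !shuffle0s /push fgliftU.
elim/last_ind: t => [|t B IHt]; first by rewrite !shuffles0 /push fgliftU.
have pZD k (a b : Z[flagT]) : push g (k *: a + b) = k *: push g a + push g b.
  by rewrite raddfD; congr (_ + _); exact: raddf_freegZ.
rewrite shuffle_rcons push_app pZD IHs IHt gD.
by rewrite !map_rcons shuffle_rcons size_map.
Qed.

Lemma push_bilift_shuffle c d : push g (P c d) = P (push g c) (push g d).
Proof.
apply: (freeg_ext (f := push g \o biliftl shuffle d) (g := biliftl shuffle (push g d) \o push g)) => s /=.
apply: (freeg_ext (f := push g \o P << s >>) (g := P (push g << s >>) \o push g)) => t /=.
by rewrite /push !fgliftU !biliftU -push_shuffle.
Qed.

End Shuffle.

Arguments flag {K V} s.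
Arguments shuffle {K V} s t.

(** * Rank and radical *)

Section SymplecticSpaces.
Variables (K : fieldType) (V : vectType K) (omega : {skew_symmetric V}).
Implicit Types (A B H U W : {vspace V}) (s : seq {vspace V}).

Notation perp := (orthov omega).
Notation symp := (is_symplectic_subspace omega).
Local Open Scope vspace_scope.

Definition radical U := (U :&: perp U)%VS.
Definition rk U := (\dim U - \dim (radical U))%N.

Lemma dim_rad U : (\dim (radical U) <= \dim U)%N.
Proof. exact/dimvS/capvSl. Qed.

Lemma dim_rk U : (rk U + \dim (radical U) = \dim U)%N.
Proof. by rewrite subnK // dim_rad. Qed.

Lemma orthovS U W : (U <= W -> perp W <= perp U)%VS.
Proof. by move=> UW; rewrite orthov_sym; apply: subv_trans UW _; rewrite orthov_sym. Qed.

Lemma rad_orthov U : (radical U <= perp U)%VS. Proof. exact: capvSr. Qed.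

Lemma sub_orthov_rad U : (U <= perp (radical U))%VS.
Proof. by rewrite orthov_sym rad_orthov. Qed.

Lemma orthov_addv U W : perp (U + W) = (perp U :&: perp W)%VS.
Proof.
apply/eqP; rewrite eqEsubv subv_cap !orthovS ?addvSl ?addvSr //=.
by rewrite orthovD capvSl capvSr.
Qed.

(** Each vector of a basis of U lowers the dimension by at most one. *)
Lemma dim_cap_orthov W U : (\dim W <= \dim (W :&: perp U) + \dim U)%N.
Proof.
have spanU (s : seq V) : (\dim W <= \dim (W :&: perp <<s>>) + size s)%N.
  elim: s => [|v s IH] /=; first by rewrite span_nil orthov0 capvf addn0.
  rewrite span_cons orthov_addv [(perp <[v]> :&: _)%VS]capvC capvA addnS.
  apply: (leq_trans IH); rewrite -addSn leq_add2r.
  have := leq_dim_orthov1 omega v (W :&: perp <<s>>)%VS.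
  by case: (\dim _).
by have := spanU (vbasis U); rewrite (span_basis (vbasisP U)) size_tuple.
Qed.

Lemma symplectic_split H U : symp H -> (H <= U)%VS ->
  (H + (U :&: perp H) = U)%VS /\ (\dim H + \dim (U :&: perp H) = \dim U)%N.
Proof.
move=> /eqP sH HU; have HB : (H :&: (U :&: perp H) = 0)%VS.
  by rewrite capvA [(H :&: U)%VS](capv_idPl _) // sH.
have dHB : \dim (H + (U :&: perp H)) = (\dim H + \dim (U :&: perp H))%N.
  exact: dimv_disjoint_sum.
have le : (H + (U :&: perp H) <= U)%VS by rewrite subv_add HU capvSl.
have eqd : (\dim H + \dim (U :&: perp H) = \dim U)%N.
  by apply/eqP; rewrite eqn_leq -{1}dHB dimvS //= addnC dim_cap_orthov.
by split=> //; apply/eqP; rewrite eqEdim le dHB eqd leqnn.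
Qed.

(** U meets the radical of W inside its own radical, so U has rank at most dim (U + rad W) - dim
    (rad W). *)
Lemma rk_mono U W : (U <= W)%VS -> (rk U <= rk W)%N.
Proof.
move=> UW; have h1 : (\dim (U + radical W) <= \dim W)%N by rewrite dimvS // subv_add UW capvSl.
have h2 : (\dim (U :&: radical W) <= \dim (radical U))%N.
  by rewrite dimvS // subv_cap capvSl /=; apply: subv_trans (capvSr _ _) _; apply: subv_trans (rad_orthov W) _; exact: orthovS.
have := dimv_sum_cap U (radical W); have := dim_rk U; have := dim_rk W; lia.
Qed.

(** The dimension grows by at most one, and the vectors of the radical orthogonal to v, a subspace
    of codimension at most one, stay in the radical. *)
Lemma rk_add_line U v : (rk (U + <[v]>) <= rk U + 2)%N.
Proof.
have h1 : (\dim (U + <[v]>) <= \dim U + 1)%N.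
  by have := dimv_sum_cap U <[v]>; rewrite dim_vline; case: (v != 0%R) => /=; lia.
have h2 : (\dim (radical U :&: perp <[v]>) <= \dim (radical (U + <[v]>)))%N.
  rewrite dimvS // subv_cap orthov_addv capvS ?capvSr // andbT.
  by apply: subv_trans (capvSl _ _) _; apply: subv_trans (capvSl _ _) _; exact: addvSl.
have := leq_dim_orthov1 omega v (radical U); have := dim_rk U; have := dim_rk (U + <[v]>); lia.
Qed.

Lemma rk_isotropic U : isotropic omega U -> rk U = 0%N.
Proof. by move=> iU; rewrite /rk /radical (capv_idPl iU) subnn. Qed.

(** The hypothesis puts B in the radical of A + B, which then contains rad A + B. *)
Lemma rk_add_radical A B : (B <= perp (A + B))%VS -> (rk (A + B) <= rk A)%N.
Proof.
move=> hB; have h1 : (\dim (radical A + B) <= \dim (radical (A + B)))%N.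
  rewrite dimvS // subv_add !subv_cap addvSr hB andbT orthov_addv subv_cap rad_orthov.
  rewrite (subv_trans (capvSl _ _) (addvSl _ _)) /= andbT.
  apply: subv_trans (capvSl _ _) _; rewrite orthov_sym; apply: subv_trans hB _.
  by apply: orthovS; exact: addvSl.
have h2 : (\dim (radical A :&: B) <= \dim (A :&: B))%N by rewrite dimvS // capvS // capvSl.
have := dimv_sum_cap A B; have := dimv_sum_cap (radical A) B.
have := dim_rk A; have := dim_rk (A + B); lia.
Qed.

Lemma rk_symplectic W : symp W = (rk W == \dim W).
Proof.
rewrite /is_symplectic_subspace -/(radical W) -dimv_eq0; have := dim_rk W; lia.
Qed.

Section Splitting.
Variable W : {vspace V}.
Hypothesis sW : symp W.

Lemma orthov_add_isotropic A B : (A <= W)%VS -> (B <= perp W)%VS -> isotropic omega B ->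
  (B <= perp (A + B))%VS.
Proof.
move=> AW BW iB; rewrite orthov_addv subv_cap andbC [X in X && _]iB.
by apply: subv_trans BW _; exact: orthovS.
Qed.

Lemma rk_add_isotropic A B : (A <= W)%VS -> (B <= perp W)%VS -> isotropic omega B ->
  (rk (A + B) <= rk A)%N.
Proof. by move=> AW BW iB; apply/rk_add_radical/orthov_add_isotropic. Qed.

Lemma symplectic_add_isotropic A B : (A <= W)%VS -> (B <= perp W)%VS -> isotropic omega B ->
  symp (A + B) -> B = 0%VS.
Proof.
move=> AW BW iB /eqP s0; apply/eqP; rewrite -subv0 -s0 subv_cap addvSr.
exact: orthov_add_isotropic.
Qed.

Lemma add_cap_orthov B : (B <= perp W)%VS -> ((W + B) :&: perp W = B)%VS.
Proof.
move=> BW; apply/eqP; rewrite eqEsubv subv_cap addvSr BW !andbT.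
apply/subvP => x /memv_capP[/memv_addP[w wW [b bB ->]] hx].
suff -> : w = 0%R by rewrite add0r.
apply/eqP; rewrite -memv0 -(eqP sW) memv_cap wW -[w](addrK b).
by rewrite rpredB //; exact: (subvP BW).
Qed.

End Splitting.

Section Alternating.
Hypothesis omega_alt : forall u, omega u u = 0%R.

(** Split off hyperbolic planes by induction on the dimension. *)
Lemma dim_symplectic_even W : symp W -> ~~ odd (\dim W).
Proof.
have [n] := ubnP (\dim W); elim: n W => // n IH W; rewrite ltnS => dW sW.
have [->|W0] := eqVneq W 0%VS; first by rewrite dimv0.
pose v := vpick W; have vW : v \in W by exact: memv_pick.
have v0 : v != 0%R by rewrite vpick0.
have /mem_orthovPn[w wW vw] : v \notin perp W.
  by apply: contra v0 => vP; rewrite -memv0 -(eqP sW) memv_cap vW.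
have wv : omega w v != 0%R by rewrite herm_eq0C.
pose H := (<[v]> + <[w]>)%VS.
have HW : (H <= W)%VS by rewrite subv_add -!memvE vW wW.
have sH : symp H.
  rewrite /is_symplectic_subspace -subv0; apply/subvP => x /memv_capP[].
  case/memv_addP => _ /vlineP[a ->] [_ /vlineP[b ->] ->].
  rewrite orthov_addv => /memv_capP[]; rewrite !mem_orthov1 !linearDl !linearZl_LR /= !omega_alt.
  rewrite !mulr0 add0r addr0 !mulf_eq0 (negbTE vw) (negbTE wv) !orbF => /eqP-> /eqP->.
  by rewrite !scale0r addr0 mem0v.
have dH : \dim H = 2%N.
  rewrite dimv_disjoint_sum ?dim_vline ?v0; last first.
    apply/eqP; rewrite -subv0; apply/subvP => x /memv_capP[/vlineP[a ->] /vlineP[b ab]].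
    rewrite memv0 scaler_eq0; apply/orP; left.
    have : omega (a *: v) w = 0%R by rewrite ab linearZl_LR /= omega_alt mulr0.
    by rewrite linearZl_LR /= => /eqP; rewrite mulf_eq0 (negbTE vw) orbF.
  suff -> : w != 0%R by [].
  by apply: contraNneq vw => ->; rewrite linear0r.
have [eW dW'] := symplectic_split sH HW.
rewrite -dW' dH oddD /=; apply: IH; first by apply: leq_trans dW; rewrite -dW' dH.
rewrite /is_symplectic_subspace -subv0 -(eqP sW); apply/subvP => x /memv_capP[/memv_capP[xW xH] xW'].
by rewrite memv_cap xW -eW orthov_addv memv_cap xH.
Qed.

(** A complement of the radical in U is symplectic, of dimension [rk U]. *)
Lemma rk_even U : ~~ odd (rk U).
Proof.
have capr : (U :&: radical U = radical U)%VS by apply/capv_idPr/capvSl.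
have -> : rk U = \dim (U :\: radical U).
  by have := dimv_cap_compl U (radical U); rewrite capr /rk => <-; rewrite addKn.
apply: dim_symplectic_even; rewrite /is_symplectic_subspace -subv0.
apply/subvP => x /memv_capP[xC xP].
have xU : x \in U by exact: (subvP (diffvSl U (radical U))).
rewrite -(capv_diff U (radical U)) memv_cap xC memv_cap xU /= -(addv_diff_cap U (radical U)) capr.
by rewrite orthov_addv memv_cap xP (subvP (sub_orthov_rad U)).
Qed.

Lemma rk_lt2 U : (rk U < 2)%N -> isotropic omega U.
Proof.
move=> h; have r0 : rk U = 0%N by have := rk_even U; case: (rk U) h => [|[]].
have eU : radical U = U by apply/eqP; rewrite eqEdim capvSl -(dim_rk U) r0 leqnn.
by rewrite /isotropic -{1}eU rad_orthov.
Qed.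

(** The radical of U lies in that of U :&: W^perp, whose rank is therefore at most rk U - dim W < 2,
    hence 0. *)
Lemma isotropic_cap_orthov W U : symp W -> (W <= U)%VS -> (rk U < \dim W + 2)%N ->
  isotropic omega (U :&: perp W).
Proof.
move=> sW WU hU; have [eU dU] := symplectic_split sW WU.
apply: rk_lt2; set B := (U :&: perp W)%VS in eU dU *.
suff h : (\dim (radical U) <= \dim (radical B))%N.
  have := dim_rk U; have := dim_rk B; lia.
rewrite dimvS // subv_cap; have -> : (radical U <= perp B)%VS.
  by apply: subv_trans (rad_orthov _) _; apply: orthovS; exact: capvSl.
by rewrite andbT capvS //; exact: orthovS.
Qed.

End Alternating.

Section Nondegenerate.
Hypothesis omega_nondeg : nondegenerate omega.

(** For a complement C of U^perp, a vector of U orthogonal to C is also orthogonal to U^perp, hence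
    to V, and is 0; so dim U is at most dim C. *)
Lemma dim_orthov U : (\dim (perp U) + \dim U = \dim (fullv : {vspace V}))%N.
Proof.
apply/eqP; rewrite eqn_leq; apply/andP; split; last first.
  by have := dim_cap_orthov fullv U; rewrite capfv.
have := dim_cap_orthov U (perp U)^C; rewrite [(U :&: _)%VS](_ : _ = 0%VS) ?dimv0 ?add0n => [h|].
  by apply: (leq_trans (leq_add (leqnn _) h)); rewrite dimv_compl subnKC // dimvS // subvf.
apply/eqP; rewrite -subv0 -(eqP omega_nondeg) -(addv_complf (perp U)) orthov_addv.
by rewrite capvS // orthov_sym.
Qed.

(** U is orthogonal to its radical, which has dimension dim U - rk U. *)
Lemma dim_bound U : (\dim U * 2 <= \dim (fullv : {vspace V}) + rk U)%N.
Proof.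
have := dim_orthov (radical U); have := dimvS (sub_orthov_rad U); have := dim_rk U; lia.
Qed.

End Nondegenerate.
End SymplecticSpaces.

(** * Cutting full flags *)

Section FullFlags.
Variables (K : fieldType) (V : vectType K).
Notation flagT := (seq {vspace V}).
Implicit Types (s t u x y : flagT) (A B U W : {vspace V}) (c d : Z[flagT]).

Lemma dim_proper U W : proper_subv U W -> (\dim U < \dim W)%N.
Proof.
by case/andP=> UW nUW; rewrite ltn_neqAle dimvS // andbT (dimv_leqif_eq UW).
Qed.

Section Bounded.
Variables (s : flagT) (m : nat).
Hypotheses (fs : flag s) (s0 : 0%VS \notin s) (sm : forall U, U \in s -> (\dim U <= m)%N).

Let ds := map (fun U => \dim U) s.

Let ds_sorted : sorted ltn ds.
Proof. by rewrite /ds sorted_map; apply: sub_sorted fs => U W; exact: dim_proper. Qed.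

Let ds_iota : {subset ds <= iota 1 m}.
Proof.
move=> _ /mapP[U Us ->]; rewrite mem_iota add1n ltnS sm // andbT lt0n dimv_eq0.
by apply: contraNneq s0 => <-.
Qed.

Let ds_uniq : uniq ds.
Proof. by apply: sorted_uniq ds_sorted => [|x]; [exact: ltn_trans | exact: ltnn]. Qed.

Lemma size_flag : (size s <= m)%N.
Proof. by have := uniq_leq_size ds_uniq ds_iota; rewrite size_map size_iota. Qed.

Lemma dim_full_flag : size s = m -> map (fun U => \dim U) s = iota 1 m.
Proof.
move=> ss; apply: (irr_sorted_eq ltn_trans ltnn ds_sorted (iota_ltn_sorted 1 m)).
by apply: (uniq_min_size ds_uniq ds_iota _).2; rewrite size_map size_iota ss.
Qed.

End Bounded.

Definition full m s := flag s /\ map (fun U => \dim U) s = iota 1 m.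

Lemma size_full m s : full m s -> size s = m.
Proof. by case=> _ h; rewrite -(size_map (fun U => \dim U)) h size_iota. Qed.

Lemma dim_nth_full m s i : full m s -> (i < m)%N -> \dim (nth 0%VS s i) = i.+1.
Proof.
move=> fs im; rewrite -(nth_map _ 0%N (fun U => \dim U)) ?(size_full fs) //.
by case: fs => _ ->; rewrite nth_iota.
Qed.

(** The part of a chain in the link of an upper flag t: what lies below t in the flags that continue
    with t from index j on. [cutr] is the mirror image. *)
Definition cutl j t : Z[flagT] -> Z[flagT] :=
  fglift (fun s => if drop j s == t then << take j s >> else 0).
HB.instance Definition _ j t := GRing.Additive.on (cutl j t).

Definition cutr j t : Z[flagT] -> Z[flagT] :=
  fglift (fun s => if take j s == t then << drop j s >> else 0).
HB.instance Definition _ j t := GRing.Additive.on (cutr j t).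

Lemma cutlU j t s : cutl j t << s >> = if drop j s == t then << take j s >> else 0.
Proof. exact: fgliftU. Qed.

Lemma cutrZ j t k c : cutr j t (k *: c) = k *: cutr j t c.
Proof. exact: raddf_freegZ. Qed.

Lemma cutrU j t s : cutr j t << s >> = if take j s == t then << drop j s >> else 0.
Proof. exact: fgliftU. Qed.

Lemma coeff_cutl s t c : coeff s (cutl (size s) t c) = coeff (s ++ t) c.
Proof.
elim/freeg_ind: c => [|c d hc hd|u]; first by rewrite raddf0 !coeff0.
  by rewrite raddfB !coeffB hc hd.
rewrite cutlU coeffU mul1r.
have -> : (u == s ++ t) = (drop (size s) u == t) && (take (size s) u == s).
  apply/eqP/andP => [->|[/eqP <- /eqP e]]; first by rewrite drop_size_cat // take_size_cat.
  by rewrite -{1}e cat_take_drop.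
by case: eqP => _; rewrite ?coeff0 // coeffU mul1r.
Qed.

Lemma supp_cutl j t c (Q Q' : flagT -> Prop) :
  (forall s, Q (s ++ t) -> Q' s) -> supp Q c -> supp Q' (cutl j t c).
Proof.
move=> h; apply: (supp_raddf (f := cutl j t)) => u Qu; rewrite /= cutlU.
by case: eqP => [e|_]; [apply: suppU; apply: h; rewrite -e cat_take_drop | exact: supp0].
Qed.

Lemma cutl_eq0 j t c (Q : flagT -> Prop) : (forall s, ~ Q (s ++ t)) -> supp Q c -> cutl j t c = 0.
Proof. by move=> h hc; apply/supp_False/(supp_cutl h hc). Qed.

Lemma cutr_eq0 j t c (Q : flagT -> Prop) : (forall s, ~ Q (t ++ s)) -> supp Q c -> cutr j t c = 0.
Proof.
move=> h hc; apply/supp_False/(supp_raddf (f := cutr j t) _ hc) => u Qu; rewrite /= cutrU.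
by case: eqP => [e|_]; [case: (h (drop j u)); rewrite -e cat_take_drop | exact: supp0].
Qed.

(* In a full flag a vertex is determined by its dimension, so only faces below U contribute. *)
Lemma bd_cutl m j U t c : supp (full m) c -> (j.+1 < m)%N -> \dim U = j.+2 ->
  bd (cutl j.+1 (U :: t) c) = cutl j (U :: t) (bd c).
Proof.
move=> hc jm dU; apply: (freeg_ext_in (f := bd \o cutl j.+1 (U :: t))
  (g := cutl j (U :: t) \o bd)) hc => s fs /=; have ss := size_full fs.
rewrite cutlU bdU raddf_sum /=.
have st : size (take j.+1 s) = j.+1 by rewrite size_takel // ss ltnW.
rewrite (bigID (fun i : 'I__ => (i < j.+1)%N)) /= [X in _ = _ + X]big1 ?addr0; last first.
  move=> i; rewrite -leqNgt => ji; rewrite raddf_freegZ /= cutlU.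
  case: eqP => [e|_]; last by rewrite scaler0.
  have := congr1 (fun r => \dim (head 0%VS r)) e; rewrite /= dU -nth0 nth_drop addn0 /face nth_cat.
  rewrite size_take (ltn_ord i) ji nth_take // (dim_nth_full fs) ?(ltn_trans _ jm) //.
  by move=> /eqP; rewrite eqSS ltn_eqF.
transitivity (\sum_(i < size s | (i < j.+1)%N) (-1) ^+ i *:
    (if drop j.+1 s == U :: t then << face (take j.+1 s) i >> else 0) : Z[flagT]); last first.
  apply: eq_bigr => i ij; rewrite raddf_freegZ /= cutlU; congr (_ *: _).
  have -> : drop j (face s i) = drop j.+1 s.
    rewrite /face drop_cat size_take (ltn_ord i) ltnNge -ltnS ij /= drop_drop.
    by congr drop; rewrite addnS subnK.
  have -> // : take j (face s i) = face (take j.+1 s) i.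
  rewrite /face take_cat size_take (ltn_ord i) ltnNge -ltnS ij /=.
  rewrite take_takel ?(ltnW ij) //; congr (_ ++ _).
  by rewrite take_drop addnS subnK.
case: eqP => _; last by rewrite raddf0 big1 // => i _; rewrite scaler0.
rewrite bdU st; rewrite (big_ord_widen_cond (size s) xpredT (fun i => (-1) ^+ i *: << face (take j.+1 s) i >>)) //.
by rewrite ss ltnW.
Qed.

(** Only the deletion of a vertex above U keeps the lower part; the sign counts the j + 1 vertices
    below. *)
Lemma bd_cutr m j U t c : supp (full m) c -> (j < m)%N -> size t = j -> \dim U = j.+1 ->
  bd (cutr j.+1 (rcons t U) c) = (-1) ^+ j.+1 *: cutr j.+1 (rcons t U) (bd c).
Proof.
move=> hc jm stj dU; rewrite -raddf_freegZ.
apply: (freeg_ext_in (f := bd \o cutr j.+1 (rcons t U))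
  (g := cutr j.+1 (rcons t U) \o ( *:%R ((-1) ^+ j.+1) \o bd))) hc => s fs /=; have ss := size_full fs.
rewrite cutrU bdU scaler_sumr raddf_sum /=.
rewrite -(big_mkord xpredT (fun i => cutr j.+1 (rcons t U) ((-1) ^+ j.+1 *: ((-1) ^+ i *: << face s i >>)))).
rewrite (big_cat_nat (n := j.+1)) //=; last by rewrite ss.
rewrite big_nat big1 ?add0r => [|i /andP[_ ij]]; last first.
  have im : (i < size s)%N by rewrite ss (leq_trans ij).
  rewrite !cutrZ cutrU; case: eqP => [e|_]; last by rewrite !scaler0.
  have := congr1 (fun r => \dim (nth 0%VS r j)) e.
  rewrite /= nth_rcons stj ltnn eqxx dU nth_take // /face nth_cat size_take im ltnNge -ltnS ij /=.
  rewrite nth_drop addSn subnKC //; case: (ltnP j.+1 m) => jm'.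
    by rewrite (dim_nth_full fs) // => /eqP; rewrite !eqSS gtn_eqF.
  by rewrite nth_default ?ss // dimv0.
rewrite [in RHS](big_addn 0 (size s) j.+1) big_mkord.
transitivity (\sum_(i < size s - j.+1)
    (if take j.+1 s == rcons t U then (-1) ^+ i *: << face (drop j.+1 s) i >> else 0) : Z[flagT]).
  case: eqP => _; last by rewrite raddf0 big1.
  by rewrite bdU size_drop.
apply: eq_bigr => i _; rewrite !cutrZ cutrU.
have im : (i + j.+1 < size s)%N by rewrite addnC -ltn_subRL.
have -> : take j.+1 (face s (i + j.+1)) = take j.+1 s.
  rewrite /face take_cat size_take im; case: ltnP => h; first by rewrite take_takel // ltnW.
  have -> : (j.+1 - (i + j.+1) = 0)%N by lia.
  by rewrite take0 cats0; congr take; lia.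
have -> : drop j.+1 (face s (i + j.+1)) = face (drop j.+1 s) i.
  rewrite /face drop_cat size_take im take_drop !drop_drop addSn; case: ltnP => // h.
  have -> : (j.+1 - (i + j.+1) = 0)%N by lia.
  by rewrite add0n [drop j.+1 _]drop_oversize // size_take im.
case: eqP => _; last by rewrite !scaler0.
rewrite scalerA [in RHS]exprD mulrCA -[(-1) ^+ j.+1 * _]exprD addnn.
by rewrite -[X in _ * X]signr_odd odd_double expr0 mulr1.
Qed.

End FullFlags.

(** * Relative cycles *)

Section RelativeCycles.
Variables (K : fieldType) (V : vectType K) (omega : {skew_symmetric V}) (n : nat).
Hypothesis omega_alt : forall u, omega u u = 0.
Hypothesis omega_nondeg : nondegenerate omega.
Hypothesis dimV : \dim (fullv : {vspace V}) = (n * 2)%N.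
Notation flagT := (seq {vspace V}).
Implicit Types (s t u : flagT) (A B U W : {vspace V}) (c d : Z[flagT]) (k : nat).
Notation perp := (orthov omega).
Notation symp := (is_symplectic_subspace omega).
Notation rk := (rk omega).
Notation radical := (radical omega).

(** The index is shifted: ranks being even, [lowrk k.+1] describes the flags of F_k, of rank at most
    2k, and [lowrk 0] allows only the empty flag. *)
Definition lowrk j : pred flagT := fun s =>
  flag s && all (fun U => (U != 0%VS) && (rk U < j * 2)%N) s.

Lemma lowrkP j s : reflect [/\ flag s, 0%VS \notin s & forall U, U \in s -> (rk U < j * 2)%N] (lowrk j s).
Proof.
apply: (iffP andP) => [[fs /allP h]|[fs s0 h]]; split=> //.
- by apply/negP => /h; rewrite eqxx.
- by move=> U /h/andP[].
by apply/allP => U Us; rewrite h // andbT; apply: contraNneq s0 => <-.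
Qed.

Lemma dim_lowrk k s U : lowrk k.+1 s -> U \in s -> (\dim U <= n + k)%N.
Proof.
by move=> /lowrkP[_ _ h] /h; have := dim_bound omega_nondeg U; rewrite dimV; lia.
Qed.

Lemma size_lowrk k s : lowrk k.+1 s -> (size s <= n + k)%N.
Proof.
move=> hs; have [fs s0 _] := lowrkP _ _ hs.
by apply: size_flag => // U; exact: dim_lowrk.
Qed.

Lemma full_lowrk k s : lowrk k.+1 s -> size s = (n + k)%N -> full (n + k) s.
Proof.
move=> hs ss; have [fs s0 _] := lowrkP _ _ hs; split=> //.
by apply: dim_full_flag => // U; exact: dim_lowrk.
Qed.

Lemma rk_last s U : flag s -> U \in s -> (rk U <= rk (last fullv s))%N.
Proof.
case/lastP: s => // s W fs Us; rewrite last_rcons; apply: rk_mono.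
by apply: flag_last fs _; rewrite inE Us orbT.
Qed.

Lemma rk_nth_last s U : flag s -> U \in s -> (rk U <= rk (nth 0%VS s (size s).-1))%N.
Proof.
case/lastP: s => // s W fs Us; rewrite size_rcons nth_rcons ltnn eqxx; apply: rk_mono.
by apply: flag_last fs _; rewrite inE Us orbT.
Qed.

(* Top-dimensional cycles of lowrk k.+1 relative to lowrk k; the default value of last makes    *)
(* them absolute cycles when k = 0, even if bd c is a multiple of the empty flag.               *)
Definition Rel k c : Prop :=
  supp (fun s => lowrk k.+1 s && (size s == n + k)%N) c /\
  supp (fun s => (rk (last fullv s) < k * 2)%N) (bd c).

Lemma RelB k c d : Rel k c -> Rel k d -> Rel k (c - d).
Proof. by move=> [c1 c2] [d1 d2]; split; rewrite ?raddfB; exact: suppB. Qed.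

Lemma Rel0 k : Rel k 0.
Proof. by split; rewrite ?raddf0; exact: supp0. Qed.

Lemma Rel_full k c : Rel k c -> supp (full (n + k)) c.
Proof. by case=> hc _; apply: suppW hc => s /andP[hs /eqP]; exact: full_lowrk. Qed.

Lemma supp_bd_flag c : supp flag c -> supp flag (bd c).
Proof. by apply: supp_bd => s i fs _; exact: flag_face. Qed.

Lemma Rel_bd_rk k c : Rel k c ->
  supp (fun s => forall U, U \in s -> (rk U < k * 2)%N) (bd c).
Proof.
move=> [hc hb] s hs U Us; apply: leq_ltn_trans (hb _ hs); apply: rk_last => //.
apply: supp_bd_flag hs; apply: suppW hc => u /andP[/lowrkP[]] //.
Qed.

Lemma Rel_bd k c : Rel k.+1 c -> Rel k (bd c).
Proof.
move=> hc; split; last by rewrite bd_bd; exact: supp0.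
move=> s hs; have hrk := Rel_bd_rk hc hs.
have : flag s /\ 0%VS \notin s /\ size s = (n + k)%N.
  move: s hs {hrk}; apply: (supp_bd _ hc.1) => s i /andP[/lowrkP[fs s0 _] /eqP ss] hi.
  split; first exact: flag_face.
  split; first by apply: contra s0; exact: mem_face.
  by rewrite size_face // ss addnS.
by move=> [fs [s0 ss]]; rewrite ss eqxx andbT; apply/lowrkP.
Qed.

(** The witness is the shuffle of c with an arbitrary line L, with the sign that undoes [eps]:
    adding L raises ranks by at most 2 and lengths by 1. *)
Lemma Rel_exact k c : (0 < n)%N -> Rel k c -> bd c = 0 -> exists2 b, Rel k.+1 b & bd b = c.
Proof.
move=> n0 [hc _] bc.
have v0 : vpick (fullv : {vspace V}) != 0 by rewrite vpick0 -dimv_eq0 dimV muln_eq0 negb_or -lt0n n0.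
set L := <[vpick (fullv : {vspace V})]>%VS.
have L0 : L != 0%VS by rewrite -dimv_eq0 dim_vline v0.
have fc : supp flag c by apply: suppW hc => s /andP[/lowrkP[]].
pose b := (-1) ^+ (n + k) *: bilift shuffle c << [:: L] >>.
have bb : bd b = c.
  rewrite /b raddf_freegZ /= bd_shuffle1 // (eps_size (n := (n + k)%N)); last first.
    by apply: suppW hc => s /andP[_ /eqP].
  exact: signrZK.
exists b => //; split; last first.
  rewrite bb; apply: suppW hc => s /andP[/lowrkP[_ _ hs] /eqP ss].
  case/lastP: s hs ss => [|s U] hs; first by rewrite /=; lia.
  by move=> _; rewrite last_rcons; apply: hs; rewrite mem_rcons mem_head.
apply: suppZ; apply: (supp_bilift (Q' := eq [:: L])) hc _; last exact: suppU.
move=> s _ /andP[/lowrkP[fs s0 hs] /eqP ss] <-.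
apply: suppW (supp_shuffle fs (t := [:: L]) isT) => u [fu su u0 uP].
rewrite su ss addn1 addnS eqxx andbT; apply/lowrkP; split=> //.
  by apply: u0; rewrite mem_cat negb_or s0 inE eq_sym.
move=> _ /uP[A [B [hA hB ->]]].
have rA : (rk A < k.+1 * 2)%N.
  move: hA; rewrite inE => /predU1P[->|/hs //]; rewrite /rk dimv0 sub0n; lia.
apply: leq_ltn_trans (rk_mono _ (W := (A + L)%VS) _) _.
  by move: hB; rewrite !inE => /orP[]/eqP->; rewrite addvS // sub0v.
by apply: leq_ltn_trans (rk_add_line _ _ _) _; rewrite mulSn addnC; lia.
Qed.

(** Otherwise U would be symplectic of dimension 2k + 1, which is odd. *)
Lemma rad_neq0 U k : (rk U < k.+1 * 2)%N -> (k * 2 < \dim U)%N -> radical U != 0%VS.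
Proof.
move=> h d; apply/negP => /eqP r0.
have sU : symp U by rewrite /is_symplectic_subspace -/(radical U) r0.
have := dim_symplectic_even omega_alt sU.
have := dim_rk omega U; rewrite r0 dimv0 addn0 => e; lia.
Qed.

(* By induction on i >= 2k, no flag of c has its first vertex of rank 2k in position i: below   *)
(* such a vertex U, joining with the radical of U is a cone.                                    *)
Lemma Rel_eq0 k c : (0 < k)%N -> (k <= n)%N -> Rel k c ->
  supp (fun s => (rk (nth 0%VS s (k * 2).-1) < k * 2)%N) c -> c = 0.
Proof.
move=> k0 kn hc h0.
have step i : (k * 2 <= i.+1)%N -> (i < n + k)%N ->
    supp (fun s => (rk (nth 0%VS s i) < k * 2)%N) c.
  elim: i => [|i IH] ki im; first by exfalso; lia.
  have [e|ki'] := eqVneq (k * 2)%N i.+2; first by move: h0; rewrite e.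
  have {}ki : (k * 2 <= i.+1)%N by lia.
  have {}IH := IH ki (ltnW im).
  move=> s0 cs0; have /andP[low0 /eqP size0] := hc.1 _ cs0; have full0 := full_lowrk low0 size0.
  rewrite ltnNge; apply/negP => rkU; set U := nth 0%VS s0 i.+1 in rkU.
  have dU : \dim U = i.+2 by rewrite (dim_nth_full full0).
  have drop0 : drop i.+1 s0 = U :: drop i.+2 s0 by rewrite (drop_nth 0%VS) // size0.
  set t := drop i.+2 s0 in drop0.
  have Us0 : U \in s0 by rewrite mem_nth // size0.
  have rkU2 : (rk U < k.+1 * 2)%N by have [_ _ ->] := lowrkP _ _ low0.
  (* By [bd_cutl] this is a cut of [bd c], all of whose vertices have rank below 2k; none of its
     flags contains U. *)
  have bdx : bd (cutl i.+1 (U :: t) c) = 0.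
    rewrite (bd_cutl t (Rel_full hc) im dU); apply: cutl_eq0 (Rel_bd_rk hc) => s.
    by move=> /(_ U); rewrite mem_cat mem_head orbT => /(_ isT); rewrite ltnNge rkU.
  set x := cutl i.+1 (U :: t) c in bdx.
  (* The induction hypothesis bounds the rank of the top vertex of a flag of x, hence by
     monotonicity the rank of every vertex. *)
  have hx : supp (fun s => [/\ flag s, 0%VS \notin s, size s = i.+1 &
      forall A, A \in s -> proper_subv A U /\ (rk A < k * 2)%N]) x.
    apply: (supp_cutl (Q := fun s => [/\ full (n + k) s, lowrk k.+1 s & (rk (nth 0%VS s i) < k * 2)%N])).
      move=> s [fs /lowrkP[fl sn0 _] rki].
      have ss : size s = i.+1.
        have := size_full fs; rewrite size_cat /= => sst.
        have := dim_nth_full (i := size s) fs; rewrite nth_cat ltnn subnn /= dU -sst.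
        by rewrite addnS ltnS leq_addr => /(_ isT)[].
      move: fl; rewrite flag_cat => /and3P[fls _ /allrelP sU]; split=> //.
        by apply: contra sn0; rewrite mem_cat => ->.
      move=> A As; split; first by apply: sU; rewrite ?mem_head.
      apply: leq_ltn_trans rki; rewrite nth_cat ss ltnSn -[i in nth _ s i]/(i.+1.-1) -ss.
      exact: rk_nth_last.
    move=> s hs; split; [exact: Rel_full hc _ hs | by have /andP[] := hc.1 _ hs | exact: IH].
  have x0 : eps x = 0.
    (* The shuffle of x with the radical would have flags of i + 2 nonzero subspaces A + B of U,
       with rank below 2k since B is in the radical. All differ from U, and below U, of dimension i
       + 2, only i + 1 of them fit. *)
    rewrite -(bd_shuffle1 (radical U)) //; last by apply: suppW hx => s [].
    rewrite [bilift _ _ _](_ : _ = 0) ?raddf0 //; apply: supp_False.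
    apply: (supp_bilift (Q' := eq [:: radical U])) hx _; last exact: suppU.
    move=> s _ [fs sn0 ss hs] <-.
    have R0 : radical U != 0%VS by apply: rad_neq0 rkU2 _; rewrite dU; lia.
    apply: suppW (supp_shuffle fs (t := [:: radical U]) isT) => u [fu su u0 uP].
    suff : (size u <= i.+1)%N by rewrite su ss addn1 ltnn.
    apply: size_flag => // [|W /uP[A [B [hA hB ->]]]].
      by apply: u0; rewrite mem_cat negb_or sn0 inE eq_sym.
    have [AU rkA] : (A <= U)%VS /\ (rk A < k * 2)%N.
      move: hA; rewrite inE => /predU1P[->|/hs[/andP[]] //].
      by rewrite sub0v /rk dimv0 sub0n muln_gt0 k0.
    have BR : (B <= radical U)%VS by move: hB; rewrite !inE => /orP[]/eqP-> //; exact: sub0v.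
    have ABU : (A + B <= U)%VS by rewrite subv_add AU (subv_trans BR) // capvSl.
    rewrite -ltnS -dU; apply: dim_proper; rewrite /proper_subv ABU /=.
    apply: contraTneq rkU => <-; rewrite -ltnNge; apply: leq_ltn_trans rkA.
    apply: rk_add_radical; apply: subv_trans BR _; apply: subv_trans (rad_orthov _ _) _.
    exact: orthovS.
  have {}x0 : x = 0.
    move: x0; rewrite (eps_size (n := i.+1)) => [/eqP|]; last by apply: suppW hx => s [].
    by move=> /eqP e; rewrite -(signrZK i.+1 x) e scaler0.
  have st : size (take i.+1 s0) = i.+1 by rewrite size_takel // size0 ltnW.
  have := coeff_cutl (take i.+1 s0) (U :: t) c; rewrite st -/x x0 coeff0 -drop0 cat_take_drop.
  by move=> e; rewrite -e eqxx in cs0.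
apply: supp_False => s hs.
have nk : (0 < n + k)%N by rewrite addn_gt0 k0 orbT.
have full_s := Rel_full hc hs.
(* The last vertex of a flag of c has dimension n + k, so rank at least 2k by [dim_bound], against
   [step]. *)
have h := dim_nth_full full_s (i := (n + k).-1).
have := step (n + k).-1; rewrite prednK // => /(_ _ _ s hs).
have := dim_bound omega_nondeg (nth 0%VS s (n + k).-1); rewrite dimV h ?prednK //.
lia.
Qed.
End RelativeCycles.

(** * Flags through a symplectic subspace *)

Section Gluing.
Variables (K : fieldType) (V : vectType K) (omega : {skew_symmetric V}) (n : nat).
Hypothesis omega_alt : forall u, omega u u = 0.
Hypothesis omega_nondeg : nondegenerate omega.
Hypothesis dimV : \dim (fullv : {vspace V}) = (n * 2)%N.
Notation flagT := (seq {vspace V}).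
Implicit Types (s t u : flagT) (A B U W : {vspace V}) (c d : Z[flagT]) (k : nat).
Notation perp := (orthov omega).
Notation symp := (is_symplectic_subspace omega).
Notation rk := (rk omega).

Lemma titsP W s : reflect [/\ flag s, 0%VS \notin s & forall U, U \in s -> proper_subv U W] (tits W s).
Proof.
apply: (iffP andP) => [[fs /allP h]|[fs s0 h]]; split=> //.
- by apply/negP => /h; rewrite eqxx.
- by move=> U /h/andP[].
by apply/allP => U Us; rewrite h // andbT; apply: contraNneq s0 => <-.
Qed.

Lemma iso_titsP W s : reflect
  [/\ flag s, 0%VS \notin s & forall U, U \in s -> (U <= W)%VS /\ isotropic omega U] (iso_tits omega W s).
Proof.
apply: (iffP andP) => [[fs /allP h]|[fs s0 h]]; split=> //.
- by apply/negP => /h; rewrite eqxx.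
- by move=> U /h/and3P[].
by apply/allP => U Us; have [-> ->] := h U Us; rewrite !andbT; apply: contraNneq s0 => <-.
Qed.

Lemma tits_top W s : tits W s -> size s != (\dim W).-1.+1.
Proof.
move=> /titsP[fs s0 h]; rewrite neq_ltn ltnS; apply/orP; left.
by apply: size_flag => // U /h/dim_proper; case: (\dim W).
Qed.

Definition glue W : Z[(flagT * flagT)%type] -> Z[flagT] :=
  fglift (fun st => shuffle (rcons st.1 W) st.2).
HB.instance Definition _ W := GRing.Additive.on (glue W).

Lemma glueU W s t : glue W << (s, t) >> = shuffle (rcons s W) t.
Proof. exact: fgliftU. Qed.

Lemma glue_cross W c d : glue W (cross c d) = bilift shuffle (rc W c) d.
Proof.
elim/freeg_ind: c => [|c c' hc hc'|s]; first by rewrite /cross !raddf0 !bilift0l raddf0.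
  by rewrite (crossBl d) !raddfB /= hc hc' biliftDl biliftNl.
elim/freeg_ind: d => [|d d' hd hd'|t]; first by rewrite /cross !raddf0.
  by rewrite (crossBr << s >>) !raddfB /= hd hd'.
by rewrite crossU glueU rcU biliftU.
Qed.

(** In a full flag the member of dimension dim W has index dim W - 1, the only place where W can
    stand. *)
Definition unglue W : Z[flagT] -> Z[(flagT * flagT)%type] :=
  fglift (fun u => if nth 0%VS u (\dim W).-1 == W
    then << (take (\dim W).-1 u, map (fun U => (U :&: perp W)%VS) (drop (\dim W) u)) >> else 0).
HB.instance Definition _ W := GRing.Additive.on (unglue W).

Lemma unglueU W u : unglue W << u >> = if nth 0%VS u (\dim W).-1 == W
    then << (take (\dim W).-1 u, map (fun U => (U :&: perp W)%VS) (drop (\dim W) u)) >> else 0.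
Proof. exact: fgliftU. Qed.

Section Summand.
Variables (k : nat) (W : {vspace V}).
Hypotheses (sW : symp W) (dW : \dim W = (k * 2)%N) (k0 : (0 < k)%N).

Lemma genus_le : (k <= n)%N.
Proof. by have := dimvS (subvf W); rewrite dimV dW leq_pmul2r. Qed.

Lemma genus_orthov : genus (perp W) = (n - k)%N.
Proof.
rewrite /genus -(addnK (\dim W) (\dim (perp W))) (dim_orthov omega_nondeg) dimV dW.
by rewrite -mulnBl muln2 doubleK.
Qed.

Lemma rk_W : rk W = (k * 2)%N.
Proof. by rewrite /rk /radical (eqP sW) dimv0 subn0. Qed.

(** W + B has dimension 2k + dim B but rank at most 2k; apply [dim_bound]. *)
Lemma dim_isotropic_orthov B : (B <= perp W)%VS -> isotropic omega B -> (\dim B <= n - k)%N.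
Proof.
move=> BW iB; have h := rk_add_isotropic (subvv W) BW iB; rewrite rk_W in h.
have := dim_bound omega_nondeg (W + B)%VS; rewrite dimV.
rewrite dimv_disjoint_sum ?dW; first by lia.
by apply/eqP; rewrite -subv0 -(eqP sW) capvS.
Qed.

Lemma iso_tits_top t : iso_tits omega (perp W) t -> size t != (genus (perp W)).+1.
Proof.
move=> /iso_titsP[ft t0 h]; rewrite genus_orthov neq_ltn ltnS; apply/orP; left.
by apply: size_flag => // U /h[]; exact: dim_isotropic_orthov.
Qed.

Lemma tits_rcons s : tits W s -> flag (rcons s W).
Proof. by move=> /titsP[fs s0 h]; rewrite flag_rcons fs; apply/allP. Qed.

(** A vertex is A + B with B in its radical, so only A contributes: rank at most 2k for A inside W,
    and at most dim A < 2k when A is a proper subspace. *)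
Lemma shuffled_rk s t u U : tits W s -> iso_tits omega (perp W) t ->
    (shuffled (rcons s W) t u -> U \in u -> (rk U < k.+1 * 2)%N) /\
  (shuffled s t u -> U \in u -> (rk U < k * 2)%N).
Proof.
move=> /titsP[_ _ hs] /iso_titsP[_ _ ht].
have isoB B : B \in 0%VS :: t -> (B <= perp W)%VS /\ isotropic omega B.
  by rewrite inE => /predU1P[->|/ht//]; rewrite /isotropic !sub0v.
split=> -[_ _ _ uP] /uP[A [B [hA /isoB[BW iB] ->]]].
  have AW : (A <= W)%VS.
    by move: hA; rewrite inE mem_rcons inE => /or3P[/eqP->|/eqP->|/hs/andP[]//]; rewrite ?sub0v.
  apply: leq_ltn_trans (rk_add_isotropic AW BW iB) _.
  by apply: leq_ltn_trans (rk_mono omega AW) _; rewrite rk_W; lia.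
have [AW dA] : (A <= W)%VS /\ (\dim A < k * 2)%N.
  move: hA; rewrite inE => /predU1P[->|/hs hA]; first by rewrite sub0v dimv0; split=> //; lia.
  by rewrite -dW (dim_proper hA); case/andP: hA.
apply: leq_ltn_trans (rk_add_isotropic AW BW iB) _.
by apply: leq_ltn_trans dA; exact: leq_subr.
Qed.

(** The flags have 2k + (n - k) vertices. As c and d are cycles, the Leibniz rule leaves as boundary
    only the product of [eps c] and d, from which W has disappeared. *)
Lemma glue_Rel c d : cycle_pred (tits W) (\dim W).-1 c ->
  cycle_pred (iso_tits omega (perp W)) (genus (perp W)) d -> Rel omega n k (glue W (cross c d)).
Proof.
move=> /andP[/chainP hc /eqP bc] /andP[/chainP hd /eqP bd0]; rewrite glue_cross.
have kn := genus_le.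
have frc : supp (fun s => exists2 s', s = rcons s' W & tits W s' && (size s' == (\dim W).-1)) (rc W c).
  apply: (supp_raddf (f := rc W)) hc => s hs /=; rewrite rcU; apply: suppU.
  by exists s.
split.
  apply: (supp_bilift _ frc hd) => _ t [s -> /andP[hs /eqP ss]] /andP[ht /eqP st].
  have [ft t0 _] := iso_titsP _ _ ht; have [_ s0 _] := titsP _ _ hs.
  apply: suppW (supp_shuffle (tits_rcons hs) ft) => u hu; have [fu su u0 _] := hu.
  rewrite su size_rcons ss st genus_orthov dW; apply/andP; split; last by apply/eqP; clear - k0 kn; lia.
  apply/lowrkP; split=> //; last by move=> U; exact: (shuffled_rk u U hs ht).1.
  apply: u0; rewrite mem_cat mem_rcons inE !negb_or s0 t0 !andbT.
  by rewrite eq_sym -dimv_eq0 dW muln_eq0 orbF -lt0n k0.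
rewrite bd_bilift_shuffle; first last.
- by apply: suppW hd => t /andP[/iso_titsP[]].
- by apply: suppW frc => _ [s -> /andP[hs _]]; exact: tits_rcons.
rewrite bd0 raddf0 addr0 bd_rc bc raddf0 add0r.
have he : supp (fun s => tits W s && (size s == (\dim W).-1)) (eps c).
  by apply: (supp_raddf (f := eps)) hc => s hs /=; rewrite epsU; apply: suppZ; exact: suppU.
apply: (supp_bilift _ he hd) => s t /andP[hs /eqP ss] /andP[ht /eqP st].
have [ft _ _] := iso_titsP _ _ ht; have [fs _ _] := titsP _ _ hs.
apply: suppW (supp_shuffle fs ft) => u hu; apply: (shuffled_rk u _ hs ht).2 => //.
(* The flag has at least 2k - 1 > 0 vertices, so [last] does not return its default. *)
have [_ su _ _] := hu; case: u hu su => [_|U u _ _]; last by rewrite /= mem_last.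
by rewrite /= ss dW => e; exfalso; lia.
Qed.

Lemma iso_tits_rcons t B : iso_tits omega (perp W) (rcons t B) ->
  [/\ iso_tits omega (perp W) t, (B <= perp W)%VS, isotropic omega B &
      forall B', B' \in 0%VS :: t -> ~~ (B <= B')%VS].
Proof.
move=> /iso_titsP[]; rewrite flag_rcons => /andP[ft tB] t0 h.
have [|BW iB] := h B; first by rewrite mem_rcons mem_head.
split=> //.
  apply/iso_titsP; split=> // [|U Ut]; first by apply: contra t0; rewrite mem_rcons inE => ->; rewrite orbT.
  by apply: h; rewrite mem_rcons inE Ut orbT.
move=> B'; rewrite inE => /predU1P[->|/(allP tB)/andP[B'B nB']].
  by rewrite subv0; apply: contraNneq t0 => <-; rewrite mem_rcons mem_head.
by apply: contra nB' => BB'; rewrite eqEsubv B'B.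
Qed.

(** A vertex A + B' equal to the symplectic W' has B' = 0 and is A = W. To have W at index 2k - 1, a
    shuffle must run through the whole flag of W before entering t; this single term has sign +1. *)
Lemma unglue_shuffle W' s t : symp W' -> \dim W' = (k * 2)%N ->
    tits W s -> size s = (\dim W).-1 -> iso_tits omega (perp W) t ->
  unglue W' (shuffle (rcons s W) t) = if W == W' then << (s, t) >> else 0.
Proof.
move=> sW' dW' hs ss; have k2 : ((k * 2).-1.+1 = k * 2)%N by lia.
have frs := tits_rcons hs; have [fs _ hsW] := titsP _ _ hs.
elim/last_ind: t => [|t B IH] ht.
  rewrite shuffles0 unglueU dW' -dW -ss nth_rcons ltnn eqxx; case: eqP => // _.
  by rewrite -cats1 take_size_cat // drop_oversize // size_cat ss addn1 dW k2.
have [ht' BW iB BB'] := iso_tits_rcons ht; have {}IH := IH ht'.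
have [ft' _ _] := iso_titsP _ _ ht'; have [ft _ _] := iso_titsP _ _ ht.
(* Below the top, these flags have only vertices of rank below 2k, and they are long enough for
   index 2k - 1 to lie below the top. *)
have z1 : unglue W' (app (W + B)%VS (shuffle s (rcons t B))) = 0.
  apply: (freeg_ext_in (f := unglue W' \o app (W + B)%VS) (g := \0)) (supp_shuffle fs ft) => u hu /=.
  rewrite appU; case: ifP => _; first by rewrite raddf0.
  have [_ su _ _] := hu; have lt_u : ((k * 2).-1 < size u)%N by rewrite su ss dW size_rcons addnS ltnS leq_addr.
  rewrite unglueU dW' nth_rcons lt_u; case: eqP => // e.
  have := (shuffled_rk u (nth 0%VS u (k * 2).-1) hs ht).2 hu (mem_nth _ lt_u).
  by rewrite e /rk /radical (eqP sW') dimv0 subn0 dW' ltnn.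
pose ext : Z[(flagT * flagT)%type] -> Z[(flagT * flagT)%type] := fglift (fun st : flagT * flagT => << (st.1, rcons st.2 B) >>).
(* W + B is a new vertex and meets W^perp in B, so appending it to the flag appends B to the second
   component. *)
have z2 : unglue W' (app (W + B)%VS (shuffle (rcons s W) t)) = ext (unglue W' (shuffle (rcons s W) t)).
  apply: (freeg_ext_in (f := unglue W' \o app (W + B)%VS) (g := fglift _ \o unglue W'))
    (supp_shuffle frs ft') => u [_ su _ uP] /=.
  have AB A B' : A \in 0%VS :: rcons s W -> B' \in 0%VS :: t ->
      [/\ (A <= W)%VS, (B' <= perp W)%VS & isotropic omega B'].
    move=> hA hB; split.
    - by move: hA; rewrite inE mem_rcons inE => /or3P[/eqP->|/eqP->|/hsW/andP[]//]; rewrite ?sub0v.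
    - by move: hB; rewrite inE => /predU1P[->|]; [rewrite sub0v | have [_ _ h] := iso_titsP _ _ ht'; case/h].
    by move: hB; rewrite inE => /predU1P[->|]; [rewrite /isotropic sub0v | have [_ _ h] := iso_titsP _ _ ht'; case/h].
  have nWB : (W + B)%VS \notin u.
    apply/negP => /uP[A [B' [hA hB e]]]; have [AW B'W _] := AB _ _ hA hB.
    have := BB' _ hB; rewrite -(add_cap_orthov sW BW) -(add_cap_orthov sW B'W) e capvS //.
    by rewrite addvS.
  have lt_u : ((k * 2).-1 < size u)%N by rewrite su size_rcons ss dW addSn ltnS leq_addr.
  rewrite appU (negbTE nWB) !unglueU dW' nth_rcons lt_u; case: eqP => e; last by rewrite raddf0.
  have [A [B' [hA hB e']]] := uP _ (mem_nth 0%VS lt_u); have [AW B'W iB'] := AB _ _ hA hB.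
  have B'0 : B' = 0%VS by apply: (symplectic_add_isotropic AW B'W iB'); rewrite -e' e.
  have eW : W' = W by apply/eqP; rewrite -e e' B'0 addv0 eqEdim AW dW -[A]addv0 -B'0 -e' e dW' leqnn.
  rewrite fgliftU /= eW -cats1 takel_cat ?(ltnW lt_u) // drop_cat.
  case: ltnP => hu; first by rewrite map_cat /= (add_cap_orthov sW BW) cats1.
  have -> : (k * 2 - size u = 0)%N by apply/eqP; rewrite subn_eq0 -k2.
  by rewrite drop0 drop_oversize //= (add_cap_orthov sW BW).
rewrite shuffle_rcons (raddfD (app _)) (raddf_freegZ (app _)) (raddfD (unglue W')) (raddf_freegZ (unglue W')) /=.
rewrite z1 scaler0 add0r z2 IH /ext; case: eqP => _; last by rewrite raddf0.
by rewrite fgliftU.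
Qed.

Lemma unglue_glue W' x : symp W' -> \dim W' = (k * 2)%N ->
  unglue W' (glue W (@tlift _ _ (tits W) (iso_tits omega (perp W)) (\dim W).-1 (genus (perp W)) x)) =
  if W == W' then tlift x else 0.
Proof.
move=> sW' dW'; elim/tensor_ind: x => [|x y hx hy|a b].
- have t0 : @tlift _ _ (tits W) (iso_tits omega (perp W)) (\dim W).-1 (genus (perp W)) 0 = 0.
    by have := tliftB (@tits_top W) iso_tits_top 0 0; rewrite !subrr.
  by rewrite t0 !raddf0 if_same.
- rewrite (tliftB (@tits_top W) iso_tits_top) !raddfB /= hx hy; case: eqP => // _; exact: subrr.
rewrite (tlift_tens (@tits_top W) iso_tits_top).
have /andP[/chainP ha _] := top_cycle_cycle a; have /andP[/chainP hb _] := top_cycle_cycle b.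
move: (top_cycle a) (top_cycle b) ha hb => c d hc hd.
have key : unglue W' (glue W (cross c d)) = (W == W')%:Z *: cross c d.
  apply: (freeg_ext_in (f := unglue W' \o (glue W \o biliftl _ d))
    (g := *:%R (W == W')%:Z \o biliftl _ d)) hc => s /andP[hs /eqP ss] /=.
  apply: (freeg_ext_in (f := unglue W' \o (glue W \o cross << s >>))
    (g := *:%R (W == W')%:Z \o cross << s >>)) hd => t /andP[ht _] /=.
  rewrite !biliftU glueU unglue_shuffle //; case: eqP => _; first by rewrite scale1r.
  by rewrite scale0r.
by rewrite key; case: eqP => _; rewrite ?scale1r ?scale0r.
Qed.

End Summand.
End Gluing.

(** * The components of a relative cycle are tensors of cycles *)

Section Ungluing.
Variables (K : fieldType) (V : vectType K) (omega : {skew_symmetric V}) (n : nat).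
Hypothesis omega_alt : forall u, omega u u = 0.
Hypothesis omega_nondeg : nondegenerate omega.
Hypothesis dimV : \dim (fullv : {vspace V}) = (n * 2)%N.
Notation flagT := (seq {vspace V}).
Implicit Types (s t u : flagT) (A B U W : {vspace V}) (c d : Z[flagT]).
Notation perp := (orthov omega).
Notation symp := (is_symplectic_subspace omega).
Notation rk := (rk omega).
Notation unglue := (unglue omega).
Variables (k : nat) (W : {vspace V}).
Hypotheses (sW : symp W) (dW : \dim W = (k * 2)%N) (k0 : (0 < k)%N).

Let kn : (k <= n)%N. Proof. exact: (genus_le dimV dW). Qed.
Let dW1 : (\dim W).-1.+1 = \dim W. Proof. by rewrite dW prednK // muln_gt0 k0. Qed.
Let dW_lt : ((\dim W).-1 < n + k)%N. Proof. by rewrite dW1 dW muln2 -addnn leq_add2r. Qed.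

Notation capW := (fun U => (U :&: perp W)%VS).

(** Above W, intersecting with W^perp and adding W are mutually inverse; the intersections are
    isotropic because the ranks are below 2k + 2. *)
Lemma flag_through u : lowrk omega k.+1 u -> size u = (n + k)%N -> nth 0%VS u (\dim W).-1 = W ->
  let s := take (\dim W).-1 u in let t := map capW (drop (\dim W) u) in
  [/\ tits W s && (size s == (\dim W).-1),
      iso_tits omega (perp W) t && (size t == genus (perp W)) &
      drop (\dim W).-1 u = W :: map (addv W) t].
Proof.
move=> hu su uW /=; have [fu u0 hrk] := lowrkP _ _ _ hu.
have du : drop (\dim W).-1 u = W :: drop (\dim W) u.
  by rewrite (drop_nth 0%VS) ?su ?uW // dW1.
have eu : u = take (\dim W).-1 u ++ W :: drop (\dim W) u by rewrite -du cat_take_drop.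
move: fu; rewrite {1}eu flag_cat => /and3P[fs ft /allrelP st].
have tW U : U \in drop (\dim W) u -> proper_subv W U.
  by move=> Ut; move: ft; rewrite /flag (sorted_pairwise (@proper_subv_trans K V)) => /andP[/allP/(_ U Ut)].
have splitW U : (W <= U)%VS -> (W + (U :&: perp W) = U)%VS.
  by move=> WU; exact: (symplectic_split sW WU).1.
have injW U U' : (W <= U)%VS -> (W <= U')%VS -> (U :&: perp W <= U' :&: perp W)%VS -> (U <= U')%VS.
  by move=> WU WU' h; rewrite -(splitW U WU) -(splitW U' WU') addvS.
split.
- rewrite size_takel ?su ?(ltnW dW_lt) // eqxx andbT; apply/titsP; split=> //.
    by apply: contra u0 => /mem_take.
  by move=> U Us; apply: st => //; rewrite mem_head.
- have size_t : (n + k - \dim W = genus (perp W))%N.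
    rewrite (genus_orthov omega_nondeg dimV dW) dW muln2 -addnn subnDr //.
  rewrite size_map size_drop su size_t eqxx andbT; apply/iso_titsP; split.
  + have ft' : flag (drop (\dim W) u) by move: ft => /path_sorted.
    rewrite /flag in ft' *; apply: (homo_sorted_in (P := fun U : {vspace V} => (W <= U)%VS) _ _ ft'); last first.
      by apply/allP => U /tW/andP[].
    move=> U U' WU WU' /andP[UU' nUU']; rewrite /proper_subv capvS //=.
    by apply: contra nUU' => /eqP e; rewrite eqEsubv UU' injW // e.
  + apply/mapP => -[U /tW/andP[WU nWU] e]; case/eqP: nWU.
    by rewrite -(splitW U WU) -e addv0.
  move=> _ /mapP[U Ut ->]; have /andP[WU _] := tW U Ut; rewrite capvSr; split=> //.
  apply: isotropic_cap_orthov => //; rewrite dW addnC -mulSn.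
  by apply: hrk; exact: mem_drop Ut.
rewrite du -map_comp; congr (_ :: _); rewrite -[LHS]map_id; apply/eq_in_map => U /tW/andP[WU _] /=.
by rewrite splitW.
Qed.

(** Expresses slices as cuts, whose boundary is known from [bd_cutl]. *)
Lemma slicel_unglue t c :
    supp (fun u => lowrk omega k.+1 u && (size u == n + k)%N) c -> all (fun B => (B <= perp W)%VS) t ->
  slicel t (unglue W c) = cutl (\dim W).-1 (W :: map (addv W) t) c.
Proof.
move=> hc ht; apply: (freeg_ext_in (f := slicel t \o unglue W) (g := cutl _ _)) hc => u /andP[hu /eqP su] /=.
rewrite unglueU cutlU; case: eqP => uW; last first.
  rewrite raddf0; case: eqP => // e; case: uW.
  by have := congr1 (nth 0%VS ^~ 0%N) e; rewrite nth_drop addn0.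
have [_ /andP[/iso_titsP[_ _ ht'] _] ->] := flag_through hu su uW.
rewrite /slicel fgliftU /=; set t' := map _ _ in ht' *.
have cancelW r : all (fun B => (B <= perp W)%VS) r -> map capW (map (addv W) r) = r.
  move=> /allP hr; rewrite -map_comp -[RHS]map_id; apply/eq_in_map => B /hr BW /=.
  exact: add_cap_orthov.
have -> // : (t' == t) = (W :: map (addv W) t' == W :: map (addv W) t).
rewrite eqseq_cons eqxx /=; apply/eqP/eqP => [-> //|e].
rewrite -(cancelW t) // -e cancelW //; apply/allP => B /ht'[] //.
Qed.

Lemma slicer_unglue s c :
    supp (fun u => lowrk omega k.+1 u && (size u == n + k)%N) c ->
  slicer s (unglue W c) = push capW (cutr (\dim W) (rcons s W) c).
Proof.
move=> hc; apply: (freeg_ext_in (f := slicer s \o unglue W)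
  (g := push capW \o cutr (\dim W) (rcons s W))) hc => u /andP[_ /eqP su] /=.
have eu : take (\dim W) u = rcons (take (\dim W).-1 u) (nth 0%VS u (\dim W).-1).
  by rewrite -[in LHS]dW1 (take_nth 0%VS) ?su.
rewrite unglueU cutrU eu eqseq_rcons andbC.
case: eqP => _ /=; last by rewrite !raddf0.
by rewrite /slicer fgliftU /=; case: eqP => _; rewrite ?raddf0 // /push fgliftU.
Qed.

Lemma supp_unglue c : supp (fun u => lowrk omega k.+1 u && (size u == n + k)%N) c ->
  supp (fun st => (tits W st.1 && (size st.1 == (\dim W).-1)) &&
                  (iso_tits omega (perp W) st.2 && (size st.2 == genus (perp W)))) (unglue W c).
Proof.
apply: (supp_raddf (f := unglue W)) => u /andP[hu /eqP su] /=; rewrite unglueU.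
case: eqP => uW; last exact: supp0.
by apply: suppU; have [/= -> -> _] := flag_through hu su uW.
Qed.

(** The boundary of the slice is a cut of [bd c] at flags through W, and [bd c] has no such flags
    since W has rank 2k. *)
Lemma unglue_cyclel c t : Rel omega n k c -> cycle_pred (tits W) (\dim W).-1 (slicel t (unglue W c)).
Proof.
move=> hc; have hu := supp_unglue hc.1; apply/andP; split.
  apply/chainP; apply: (supp_raddf (f := slicel t)) hu => -[x y] /= /andP[hx _].
  by rewrite /slicel fgliftU; case: ifP => _; [exact: suppU | exact: supp0].
(* A flag t not inside W^perp never occurs as second component, so its slice is 0. *)
have [ht|ht] := boolP (all (fun B => (B <= perp W)%VS) t); last first.
  rewrite [slicel _ _](_ : _ = 0) ?raddf0 //; apply: supp_False.
  apply: (supp_raddf (f := slicel t)) hu => -[x y] /= /andP[_ /andP[/iso_titsP[_ _ hy] _]].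
  rewrite /slicel fgliftU /=; case: eqP => [e|_]; last exact: supp0.
  by case/negP: ht; apply/allP => B; rewrite -e => /hy[].
have dW2 : \dim W = (k.-1 * 2).+2 by rewrite dW -[k in LHS]prednK.
rewrite (slicel_unglue hc.1 ht) dW2 /= (bd_cutl _ (Rel_full omega_nondeg dimV hc)) //; last first.
  by have := dW_lt; rewrite dW2.
apply/eqP; apply: cutl_eq0 (Rel_bd_rk hc) => s /(_ W); rewrite mem_cat mem_head orbT => /(_ isT).
by rewrite (rk_W sW dW) ltnn.
Qed.

Lemma unglue_cycler c s : Rel omega n k c ->
  cycle_pred (iso_tits omega (perp W)) (genus (perp W)) (slicer s (unglue W c)).
Proof.
move=> hc; have hu := supp_unglue hc.1; apply/andP; split.
  apply/chainP; apply: (supp_raddf (f := slicer s)) hu => -[x y] /= /andP[_ hy].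
  by rewrite /slicer fgliftU; case: ifP => _; [exact: suppU | exact: supp0].
have [ss|ss] := eqVneq (size s) (\dim W).-1; last first.
  rewrite [slicer _ _](_ : _ = 0) ?raddf0 //; apply: supp_False.
  apply: (supp_raddf (f := slicer s)) hu => -[x y] /= /andP[/andP[_ sx] _].
  rewrite /slicer fgliftU /=; case: eqP => [e|_]; last exact: supp0.
  by rewrite -e sx in ss.
have e : bd (cutr (\dim W).-1.+1 (rcons s W) c) = 0.
  rewrite (bd_cutr (Rel_full omega_nondeg dimV hc) dW_lt ss (esym dW1)).
  rewrite [cutr _ _ _](_ : _ = 0) ?scaler0 //.
  apply: cutr_eq0 (Rel_bd_rk hc) => u /(_ W); rewrite mem_cat mem_rcons mem_head => /(_ isT).
  by rewrite (rk_W sW dW) ltnn.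
by rewrite (slicer_unglue s hc.1) bd_push -[X in cutr X]dW1 e raddf0.
Qed.

Lemma unglue_surj c : Rel omega n k c ->
  exists x, @tlift _ _ (tits W) (iso_tits omega (perp W)) (\dim W).-1 (genus (perp W)) x = unglue W c.
Proof.
move=> hc; apply: (tlift_surj (@tits_top _ _ W) (iso_tits_top omega_nondeg dimV sW dW k0)) => [t|s].
  exact: unglue_cyclel.
exact: unglue_cycler.
Qed.

Lemma unglue_eq0 c u : Rel omega n k c -> unglue W c = 0 -> coeff u c != 0 ->
  nth 0%VS u (\dim W).-1 != W.
Proof.
move=> hc c0 cu; apply/eqP => uW; have /andP[hu /eqP su] := hc.1 _ cu.
have [/andP[_ /eqP ss] /andP[/iso_titsP[_ _ ht] _] du] := flag_through hu su uW.
have hall : all (fun B => (B <= perp W)%VS) (map capW (drop (\dim W) u)).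
  by apply/allP => B /ht[].
have := coeff_cutl (take (\dim W).-1 u) (drop (\dim W).-1 u) c.
rewrite cat_take_drop ss du -(slicel_unglue hc.1 hall) c0 raddf0 coeff0 => e.
by rewrite -e eqxx in cu.
Qed.

End Ungluing.

(** * The terms of the resolution *)

Lemma additiveP (A B : zmodType) (f : A -> B) : {morph f : x y / x - y} ->
  exists d : {additive A -> B}, d =1 f.
Proof.
move=> fB; pose m := GRing.isZmodMorphism.Build A B f fB.
by exists (HB.pack_for {additive A -> B} f m).
Qed.

Lemma top_cycle_map (T T' : choiceType) (phi : T -> T') (X : pred (seq T)) (Y : pred (seq T')) p q x :
    (forall s, X s -> size s != p.+1) -> (forall s, Y s -> size s != q.+1) ->
    p = q -> (forall s, X s -> Y (map phi s)) ->
  top_cycle (@rhom_map T T' phi X Y p q x) = push phi (top_cycle x).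
Proof.
move=> Xt Yt pq XY; have [z ->] := rhom_pi_surj x.
by rewrite (rhom_map_pi pq XY) !top_cycle_pi // val_cycle_map.
Qed.

Lemma push_rc (T T' : choiceType) (phi : T -> T') a c : push phi (rc a c) = rc (phi a) (push phi c).
Proof.
apply: (freeg_ext (f := push phi \o rc a) (g := rc (phi a) \o push phi)) => s /=.
by rewrite rcU /push !fgliftU rcU map_rcons.
Qed.

Section DirectSumLift.
Variables (I : choiceType) (M : I -> zmodType) (N : zmodType) (h : forall i, M i -> N).
Hypothesis hB : forall i, {morph @h i : x y / x - y}.

Definition dsum_lift (f : dsum M) : N := \sum_(i <- undup (sval (cid (dsum_support f)))) h (f i).

Let h0 i : h (0 : M i) = 0. Proof. by have := hB (0 : M i) 0; rewrite !subrr. Qed.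

(** Zero entries contribute nothing, so the sum does not depend on the chosen finite support. *)
Lemma dsum_liftE (f : dsum M) s : uniq s -> (forall i, i \notin s -> f i = 0) ->
  dsum_lift f = \sum_(i <- s) h (f i).
Proof.
have nz t : \sum_(i <- t) h (f i) = \sum_(i <- [seq i <- t | f i != 0]) h (f i).
  rewrite big_filter [LHS](bigID (fun i => f i != 0)) /= [X in _ + X]big1 ?addr0 // => i.
  by rewrite negbK => /eqP->; exact: h0.
move=> us hs; rewrite /dsum_lift; case: cid => t ht /=.
rewrite nz [RHS]nz; apply: perm_big; apply: uniq_perm; rewrite ?filter_uniq ?undup_uniq // => i.
rewrite !mem_filter mem_undup; case: eqP => //= fi.
have -> : i \in t by apply: contraT => /ht.
by apply: esym; apply: contraT => /hs.
Qed.

Lemma dsum_liftB : {morph dsum_lift : f g / f - g}.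
Proof.
move=> f g; have [s hs] := dsum_support f; have [t ht] := dsum_support g.
have us := undup_uniq (s ++ t).
have memu i : i \notin undup (s ++ t) -> i \notin s /\ i \notin t.
  by rewrite mem_undup mem_cat negb_or => /andP.
have hf i : i \notin undup (s ++ t) -> f i = 0 by case/memu => /hs.
have hg i : i \notin undup (s ++ t) -> g i = 0 by case/memu => _ /ht.
have hfg i : i \notin undup (s ++ t) -> (f - g) i = 0.
  by move=> hi; rewrite -[LHS]/(f i - g i) hf // hg // subr0.
rewrite (dsum_liftE us hfg) (dsum_liftE us hf) (dsum_liftE us hg) -sumrB.
by apply: eq_bigr => i _; rewrite -hB.
Qed.

End DirectSumLift.

Section Realization.
Variables (K : fieldType) (V : vectType K) (omega : {skew_symmetric V}) (n : nat).
Hypothesis omega_alt : forall u, omega u u = 0.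
Hypothesis omega_nondeg : nondegenerate omega.
Hypothesis dimV : \dim (fullv : {vspace V}) = (n * 2)%N.
Hypothesis n_gt0 : (0 < n)%N.
Notation flagT := (seq {vspace V}).
Implicit Types (s t u : flagT) (A B U W : {vspace V}) (c d : Z[flagT]) (g : Sp omega).
Notation perp := (orthov omega).
Notation symp := (is_symplectic_subspace omega).
Notation rk := (rk omega).
Notation Rel := (Rel omega n).

(** F is an equivariant isomorphism from M onto the group [Rel k]. *)
Definition realizes k (M : gmodType (Sp omega)) (F : M -> Z[flagT]) : Prop :=
  [/\ {morph F : x y / x - y}, injective F,
      forall g x, F (gact g x) = push (vact g) (F x) &
      forall c, Rel k c <-> exists x, F x = c].

Lemma vactD g : {morph vact g : A B / (A + B)%VS}.
Proof. by move=> A B; exact: limgD. Qed.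

Let genusV : genus (fullv : {vspace V}) = n.
Proof. by rewrite /genus dimV muln2 doubleK. Qed.

Lemma iso_tits_fullv s : iso_tits omega fullv s = lowrk omega 1 s.
Proof.
apply/iso_titsP/lowrkP => -[fs s0 h]; split=> // U /h; first by case=> _ /rk_isotropic ->.
by rewrite mul1n => /(rk_lt2 omega_alt); rewrite subvf.
Qed.

Lemma iso_tits_fullv_top s : iso_tits omega fullv s -> size s != (genus (fullv : {vspace V})).+1.
Proof.
rewrite iso_tits_fullv genusV => hs; rewrite neq_ltn ltnS.
by have := size_lowrk omega_nondeg dimV hs; rewrite addn0 => ->.
Qed.

(** Rank below 2 means isotropic, and a boundary supported in rank below 0 is 0, so [Rel 0] consists
    of the top cycles of the isotropic building. *)
Lemma realizes0 : realizes 0 (M := StwV omega) (@top_cycle _ (iso_tits omega fullv) (genus (fullv : {vspace V}))).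
Proof.
split=> [||g x|c].
- exact: (top_cycleB iso_tits_fullv_top).
- exact: (top_cycle_inj iso_tits_fullv_top).
- apply: top_cycle_map => //; [exact: iso_tits_fullv_top | exact: iso_tits_fullv_top |].
  by move=> s hs; rewrite -(vactf g); exact: iso_tits_vact.
have -> : Rel 0 c <-> cycle_pred (iso_tits omega fullv) n c.
  split=> [[hc hb]|/andP[/chainP hc /eqP hb]].
    apply/andP; split; last by apply/eqP/supp_False; apply: suppW hb.
    by apply/chainP => s /hc; rewrite iso_tits_fullv addn0.
  by split=> [s /hc|]; rewrite ?hb; [rewrite iso_tits_fullv addn0 | exact: supp0].
rewrite -genusV; split=> [/(top_cycle_surj iso_tits_fullv_top)//|[x <-]].
exact: top_cycle_cycle.
Qed.

(** A flag with 2n members ends in V, so a chain of such flags is a cone with apex V; its boundary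
    avoids V precisely when the base is a cycle. *)
Lemma realizesn : realizes n (M := StV V) (fun x => rc fullv (@top_cycle _ (tits fullv) (\dim (fullv : {vspace V})).-1 x)).
Proof.
have ttop := @tits_top _ _ (fullv : {vspace V}).
have n2 : ((n * 2).-1.+1 = n * 2)%N by rewrite prednK // muln_gt0 n_gt0.
have n2' : ((n * 2).-1 = (n.-1 * 2).+1)%N by rewrite -[n in LHS]prednK.
have cutlK c : supp (fun s => size s = (n * 2).-1) c -> cutl (n * 2).-1 [:: fullv] (rc fullv c) = c.
  apply: (freeg_ext_in (f := cutl (n * 2).-1 [:: fullv] \o rc fullv) (g := idfun)) => s ss /=.
  by rewrite rcU cutlU -ss -cats1 drop_size_cat // take_size_cat // eqxx.
have size_tc (x : St fullv) : supp (fun s => size s = (n * 2).-1) (top_cycle x).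
  by have /andP[/chainP h _] := top_cycle_cycle x; apply: suppW h => s /andP[_ /eqP]; rewrite dimV.
split=> [x y|x y|g x|c].
- by rewrite (top_cycleB ttop) raddfB.
- move=> /(congr1 (cutl (n * 2).-1 [:: fullv])).
  by rewrite !cutlK // => /(top_cycle_inj ttop).
- have -> : top_cycle (gact g x) = push (vact g) (top_cycle x).
    apply: top_cycle_map => // s hs; rewrite -(vactf g); exact: tits_vact.
  by rewrite push_rc vactf.
split=> [hc|[x <-]]; last first.
  have /andP[/chainP hx /eqP bx] := top_cycle_cycle x; set e := top_cycle x in hx bx *.
  split.
    apply: (supp_raddf (f := rc fullv)) hx => s /andP[/titsP[fs s0 hs] /eqP ss] /=.
    rewrite rcU; apply: suppU; rewrite size_rcons ss dimV n2 muln2 addnn eqxx andbT; apply/lowrkP; split.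
    - by rewrite flag_rcons fs; apply/allP.
    - rewrite mem_rcons inE negb_or s0 andbT eq_sym -dimv_eq0 dimV muln_eq0 orbF -lt0n //.
    - move=> U _; apply: leq_ltn_trans (leq_subr _ _) _.
      by apply: leq_ltn_trans (dimvS (subvf U)) _; rewrite dimV ltn_pmul2r.
  rewrite bd_rc bx raddf0 add0r; apply: (supp_raddf (f := eps)) hx => s /andP[/titsP[fs s0 hs] /eqP ss] /=.
  rewrite epsU; apply: suppZ; apply: suppU; apply: leq_ltn_trans (leq_subr _ _) _.
  rewrite -dimV; apply: dim_proper; apply: hs; case: s ss {fs s0} => [|U s _]; last by rewrite /= mem_last.
  by rewrite dimV /= n2'.
have hfull := Rel_full omega_nondeg dimV hc.
have cE : rc fullv (cutl (n * 2).-1 [:: fullv] c) = c.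
  apply: (freeg_ext_in (f := rc fullv \o cutl (n * 2).-1 [:: fullv]) (g := idfun)) hfull => s fs /=.
  have ss := size_full fs; have lt_s : ((n * 2).-1 < size s)%N by rewrite ss n2 muln2 addnn.
  have e : nth 0%VS s (n * 2).-1 = fullv.
    have lt_n : ((n * 2).-1 < n + n)%N by rewrite -ss.
    by apply/eqP; rewrite eqEdim subvf (dim_nth_full fs lt_n) n2 dimV /=.
  have ds : drop (n * 2).-1 s = [:: fullv].
    by rewrite (drop_nth 0%VS) // e n2 drop_oversize // ss muln2 addnn.
  by rewrite cutlU ds eqxx rcU -cats1 -ds cat_take_drop.
suff /(top_cycle_surj ttop)[x xE] : cycle_pred (tits fullv) (\dim (fullv : {vspace V})).-1 (cutl (n * 2).-1 [:: fullv] c).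
  by exists x; rewrite xE.
apply/andP; split.
  apply/chainP; rewrite dimV.
  apply: (supp_cutl (Q := fun s => lowrk omega n.+1 s && (size s == n + n)%N)) hc.1 => s.
  rewrite size_cat /= addn1 => /andP[/lowrkP[]]; rewrite flag_cat => /and3P[fs _ /allrelP hs] s0 _ ss.
  apply/andP; split; last by rewrite -eqSS n2 muln2 -addnn.
  apply/titsP; split=> //; first by apply: contra s0; rewrite mem_cat => ->.
  by move=> U Us; apply: hs; rewrite ?mem_head.
rewrite n2' (bd_cutl _ hfull) ?dimV; last 2 first.
- by rewrite addnn -muln2 -n2' n2.
- by rewrite -[n in LHS]prednK.
apply/eqP; apply: cutl_eq0 (Rel_bd_rk hc) => s /(_ fullv); rewrite mem_cat mem_head orbT => /(_ isT).
by rewrite (rk_W _ dimV) ?ltnn // /is_symplectic_subspace capfv.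
Qed.

Section SummandChains.
Variables (k : nat) (W : {vspace V}).
Hypotheses (sW : symp W) (dW : \dim W = (k * 2)%N) (k_gt0 : (0 < k)%N).

Let tens_of (U : {vspace V}) : zmodType :=
  tensor (rhom (tits U) (\dim U).-1) (rhom (iso_tits omega (perp U)) (genus (perp U))).

Let tcycle (U : {vspace V}) : tens_of U -> Z[(flagT * flagT)%type] :=
  @tlift _ _ (tits U) (iso_tits omega (perp U)) (\dim U).-1 (genus (perp U)).

Let ttop := @tits_top _ _ W.
Let itop := iso_tits_top omega_nondeg dimV sW dW k_gt0.

Lemma glue_tlift_Rel (x : tens_of W) : Rel k (glue W (tcycle x)).
Proof.
have t0 : tcycle (0 : tens_of W) = 0 by have := tliftB ttop itop 0 0; rewrite !subrr.
elim/tensor_ind: x => [|x y hx hy|a b]; first by rewrite t0 raddf0; exact: Rel0.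
  by rewrite /tcycle (tliftB ttop itop) raddfB; exact: RelB.
rewrite /tcycle (tlift_tens ttop itop).
apply: (glue_Rel omega_nondeg dimV sW dW k_gt0); exact: top_cycle_cycle.
Qed.

Lemma glue_tlift_vact g (x : tens_of W) :
  glue (vact g W) (@tcycle (vact g W) (tensor_map
    (@rhom_map _ _ (vact g) (tits W) (tits (vact g W)) (\dim W).-1 (\dim (vact g W)).-1)
    (@rhom_map _ _ (vact g) (iso_tits omega (perp W)) (iso_tits omega (perp (vact g W)))
       (genus (perp W)) (genus (perp (vact g W)))) x)) =
  push (vact g) (glue W (tcycle x)).
Proof.
have sgW : symp (vact g W) by rewrite vact_symplectic.
have dgW : \dim (vact g W) = (k * 2)%N by rewrite dim_vact.
have ttop' := @tits_top _ _ (vact g W).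
have itop' := iso_tits_top omega_nondeg dimV sgW dgW k_gt0.
have t0 : tcycle (0 : tens_of W) = 0 by have := tliftB ttop itop 0 0; rewrite !subrr.
have t0' : tcycle (0 : tens_of (vact g W)) = 0 by have := tliftB ttop' itop' 0 0; rewrite !subrr.
have ed : (\dim W).-1 = (\dim (vact g W)).-1 by rewrite dim_vact.
have eg : genus (perp W) = genus (perp (vact g W)) by rewrite -vact_orthov /genus dim_vact.
have isoW s : iso_tits omega (perp W) s -> iso_tits omega (perp (vact g W)) (map (vact g) s).
  by rewrite -vact_orthov; exact: iso_tits_vact.
have fD := rhom_mapD ed (@tits_vact _ _ _ g W); have hD := rhom_mapD eg isoW.
have mD := tensor_mapD fD hD; set F := tensor_map _ _ in mD *.
have m0 : F 0 = 0 by have := mD 0 0; rewrite addr0 -[LHS]addr0 => /addrI <-.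
have mB : {morph F : u v / u - v} by move=> u v; apply: (addIr (F v)); rewrite -mD !subrK.
elim/tensor_ind: x => [|x y hx hy|a b].
- by rewrite m0 t0 t0' !raddf0.
- by rewrite mB /tcycle (tliftB ttop' itop') (tliftB ttop itop) !raddfB /= -hx -hy.
rewrite /F /tens (tensor_map_pi fD hD) tensor_preU /tcycle.
rewrite (tlift_tens ttop' itop') (tlift_tens ttop itop) !glue_cross push_bilift_shuffle; last 2 first.
- exact: vact_inj.
- exact: vactD.
rewrite push_rc (top_cycle_map _ ttop ttop' ed) //; last exact: tits_vact.
by rewrite (top_cycle_map _ itop itop' eg).
Qed.

End SummandChains.

Section Middle.
Variable k : nat.
Hypothesis k_gt0 : (0 < k)%N.
Implicit Type w : symp_subspace omega k.

Let wS w : symp w. Proof. by case: w => W /= /andP[]. Qed.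

Let wdim w : \dim w = (k * 2)%N.
Proof.
have /andP[sW /eqP e] : is_symp_genus omega k w by case: w.
by rewrite -[RHS](congr1 (muln^~ 2) e) muln2 /genus -[LHS]odd_double_half (negbTE (dim_symplectic_even omega_alt sW)).
Qed.

Definition summand_cycle w : summand w -> Z[(flagT * flagT)%type] :=
  @tlift _ _ (tits w) (iso_tits omega (perp w)) (\dim w).-1 (genus (perp w)).

Let ttop w := @tits_top _ _ (w : {vspace V}).
Let itop w := iso_tits_top omega_nondeg dimV (wS w) (wdim w) k_gt0.

Let summand_cycleB w : {morph @summand_cycle w : x y / x - y}.
Proof. exact: (tliftB (@ttop w) (@itop w)). Qed.

Let summand_cycle0 w : summand_cycle (0 : summand w) = 0.
Proof. by have := summand_cycleB (0 : summand w) 0; rewrite !subrr. Qed.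

Definition chain_of w (x : summand w) : Z[flagT] := glue w (summand_cycle x).

Let chain_ofB w : {morph @chain_of w : x y / x - y}.
Proof. by move=> x y; rewrite /chain_of summand_cycleB raddfB. Qed.

Lemma chain_of_Rel w (x : summand w) : Rel k (chain_of x).
Proof. exact: (glue_tlift_Rel (wS w) (wdim w) k_gt0). Qed.

Lemma chain_of_equivariant g w (x : summand w) :
  chain_of (summand_map g (symp_act g w) x) = push (vact g) (chain_of x).
Proof. exact: (glue_tlift_vact (wS w) (wdim w) k_gt0). Qed.

Definition sum_chain (f : StSum omega k) : Z[flagT] := dsum_lift chain_of f.

Lemma unglue_sum_chain w (f : StSum omega k) : unglue omega w (sum_chain f) = summand_cycle (f w).
Proof.
have [s hs] := dsum_support f; pose r := undup s.
have hr i : i \notin r -> f i = 0 by rewrite mem_undup => /hs.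
rewrite /sum_chain (dsum_liftE chain_ofB (undup_uniq s) hr) raddf_sum /=.
have one w' : unglue omega w (chain_of (f w')) = if w' == w then summand_cycle (f w') else 0.
  rewrite /chain_of (unglue_glue omega_nondeg dimV (wS w') (wdim w') k_gt0 _ (wS w) (wdim w)).
  by rewrite (inj_eq val_inj).
under eq_bigr do rewrite one.
rewrite -big_mkcond /=; have [wr|wr] := boolP (w \in r).
  rewrite -big_filter (perm_big [:: w]) ?big_seq1 //; apply: uniq_perm => //.
    by rewrite filter_uniq ?undup_uniq.
  by move=> i; rewrite mem_filter inE; case: eqP => // ->; rewrite wr.
rewrite (hr w wr) summand_cycle0 big_seq_cond big1 // => i /andP[ir /eqP iw].
by rewrite -iw ir in wr.
Qed.

(** The components are recovered by [unglue], which gives injectivity; for surjectivity they are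
    prescribed by ungluing c at every symplectic subspace of genus k. *)
Lemma realizes_sum : (k <= n)%N -> realizes k (M := StSum omega k) sum_chain.
Proof.
move=> kn; split.
- exact: (dsum_liftB chain_ofB).
- move=> x y exy; apply: dsumP => w; apply: (tlift_inj (@ttop w) (@itop w)).
  by rewrite -!/(summand_cycle _) -!unglue_sum_chain exy.
- move=> g f; have [s hs] := dsum_support f; pose r := undup s.
  have hr i : i \notin r -> f i = 0 by rewrite mem_undup => /hs.
  pose r' := map (symp_act g) r.
  have ur' : uniq r' by rewrite map_inj_uniq ?undup_uniq //; exact: can_inj (symp_actK g).
  have hr' i : i \notin r' -> (gact g f : StSum omega k) i = 0.
    move=> ir; rewrite -[LHS]/(summand_map g i (f (symp_act g^-1%g i))) hr; last first.
      by apply: contra ir => /(map_f (symp_act g)); rewrite symp_actVK.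
    have := summand_mapD (symp_actVK g i) 0 0.
    by rewrite addr0 -[LHS]addr0 => /addrI <-.
  rewrite /sum_chain (dsum_liftE chain_ofB ur' hr') (dsum_liftE chain_ofB (undup_uniq s) hr).
  rewrite raddf_sum big_map; apply: eq_bigr => w _ /=.
  rewrite -chain_of_equivariant; congr chain_of.
  rewrite -[LHS]/(summand_map g (symp_act g w) (f (symp_act g^-1%g (symp_act g w)))).
  by apply: summand_map_dep; exact: symp_actK.
move=> c; have sum_Rel (f : StSum omega k) : Rel k (sum_chain f).
  have RN d : Rel k d -> Rel k (- d) by rewrite -sub0r => hd; apply: RelB hd; exact: Rel0.
  apply: (big_ind (Rel k)) => [|d e hd he|w _]; [exact: Rel0 | | exact: chain_of_Rel].
  by rewrite -[e]opprK; apply: RelB => //; exact: RN.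
split=> [hc|[f <-]]; last exact: sum_Rel.
have exf w : exists x : summand w, summand_cycle x = unglue omega w c.
  exact: (unglue_surj omega_alt omega_nondeg dimV (wS w) (wdim w) k_gt0 hc).
pose f w := sval (cid (exf w)).
have fP w : summand_cycle (f w) = unglue omega w c by rewrite /f; case: cid.
(* Only subspaces at index 2k - 1 in one of the finitely many flags of c can have a nonzero
   component. *)
pose s : seq (symp_subspace omega k) := pmap insub (map (fun u => nth 0%VS u (k * 2).-1) (dom c)).
have fs : finitely_supported f.
  apply/asboolP; exists s => w ws; apply: (tlift_inj (@ttop w) (@itop w)).
  rewrite -!/(summand_cycle _) fP summand_cycle0.
  apply: (freeg_ext_in (f := unglue omega w) (g := \0) _ (@suppP _ c)) => u uc /=.
  rewrite unglueU wdim; case: eqP => // e; case/negP: ws.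
  by rewrite mem_pmap_sub; apply/mapP; exists u.
(* The difference has zero component everywhere, so by [unglue_eq0] its flags avoid all symplectic
   subspaces of genus k, and [Rel_eq0] applies. *)
exists (DSum fs : StSum omega k); apply/eqP; rewrite eq_sym -subr_eq0; apply/eqP.
have hR : Rel k (c - sum_chain (DSum fs)) by exact: RelB.
apply: (Rel_eq0 omega_alt omega_nondeg dimV k_gt0 kn hR) => u hu.
rewrite ltnNge; apply/negP => rkU; set U := nth 0%VS u (k * 2).-1 in rkU.
have k2 : ((k * 2).-1.+1 = k * 2)%N by rewrite prednK // muln_gt0 k_gt0.
have dU : \dim U = (k * 2)%N.
  rewrite (dim_nth_full (Rel_full omega_nondeg dimV hR hu)) k2 //.
  by rewrite muln2 -addnn leq_add2r.
have sU : symp U by rewrite rk_symplectic dU eqn_leq rkU andbT -dU leq_subr.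
have hw : is_symp_genus omega k U by rewrite /is_symp_genus sU /genus dU muln2 doubleK eqxx.
have := unglue_eq0 omega_alt omega_nondeg dimV sU dU k_gt0 hR _ hu.
rewrite raddfB /= (unglue_sum_chain (SympSubspace hw)) fP subrr dU eqxx => /(_ erefl).
by [].
Qed.

End Middle.
End Realization.

(** * Transport of the differentials and exactness *)

Section Resolution.
Variables (K : fieldType) (V : vectType K) (omega : {skew_symmetric V}) (n : nat).
Hypothesis omega_alt : forall u, omega u u = 0.
Hypothesis omega_nondeg : nondegenerate omega.
Hypothesis dimV : \dim (fullv : {vspace V}) = (n * 2)%N.
Hypothesis n_gt0 : (0 < n)%N.
Notation flagT := (seq {vspace V}).
Notation Rel := (Rel omega n).
Notation term := (resolution_term omega n).

Lemma exists_realization k : (k <= n)%N -> exists F : term k -> Z[flagT], realizes n k F.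
Proof.
move=> kn; rewrite /resolution_term; case: eqP => [->|/eqP k0].
  by eexists; exact: realizes0.
case: eqP => [->|_]; first by eexists; exact: realizesn.
by eexists; apply: realizes_sum => //; rewrite lt0n.
Qed.

(** Such a c bounds an element of [Rel n.+1], which is 0 because no flag in V has 2n + 1 nonzero
    members. *)
Lemma Rel_top_cycle c : Rel n c -> bd c = 0 -> c = 0.
Proof.
move=> hc bc; have [b hb <-] := Rel_exact omega_nondeg dimV n_gt0 hc bc.
rewrite [b](_ : _ = 0) ?raddf0 //; apply: supp_False.
apply: suppW hb.1 => s /andP[/lowrkP[fs s0 _] /eqP ss].
have : (size s <= n * 2)%N.
  by apply: size_flag => // U _; rewrite -dimV; exact/dimvS/subvf.
by rewrite ss addnS muln2 -addnn ltnn.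
Qed.

(** [bd] maps [Rel k.+1] to [Rel k], and d is its conjugate; injectivity of F makes d additive and
    equivariant. *)
Lemma exists_differential k (F : term k -> Z[flagT]) (F' : term k.+1 -> Z[flagT]) :
    realizes n k F -> realizes n k.+1 F' ->
  exists d : {additive term k.+1 -> term k}, equivariant d /\ forall x, F (d x) = bd (F' x).
Proof.
move=> [FB Finj Fact FP] [F'B _ F'act F'P].
have exd x : exists y, F y = bd (F' x).
  by apply/FP/Rel_bd/F'P; exists x.
pose d0 x := sval (cid (exd x)).
have d0P x : F (d0 x) = bd (F' x) by rewrite /d0; case: cid.
have [d dE] : exists d : {additive term k.+1 -> term k}, d =1 d0.
  by apply: additiveP => x y; apply: Finj; rewrite FB !d0P F'B raddfB.
exists d; split=> [g x|x]; last by rewrite dE.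
by apply: Finj; rewrite Fact !dE !d0P F'act bd_push.
Qed.

End Resolution.

Theorem proposition1p7 (K : fieldType) (V : vectType K)
    (omega : {skew_symmetric V}) (n : nat)
    (omega_alt : forall u, omega u u = 0)
    (omega_nondeg : nondegenerate omega)
    (n_gt0 : (0 < n)%N)
    (genusV : genus (fullv : {vspace V}) = n) :
  exists d : forall k : nat,
      {additive resolution_term omega n k.+1 -> resolution_term omega n k},
    [/\ forall k, equivariant (d k),
        forall k, k.+1 = n -> injective (d k),
        forall k, (k.+1 < n)%N -> exact_at (d k.+1) (d k)
      & forall y, exists x, d 0%N x = y].
Proof.
have dimV : \dim (fullv : {vspace V}) = (n * 2)%N.
  (* The dimension is even, so the halving in [genus] loses nothing. *)
  have sV : is_symplectic_subspace omega fullv by rewrite /is_symplectic_subspace capfv.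
  rewrite -genusV /genus muln2 -[LHS]odd_double_half.
  by rewrite (negbTE (dim_symplectic_even omega_alt sV)).
have exF k : exists F : resolution_term omega n k -> {freeg (seq {vspace V}) / int},
    (k <= n)%N -> realizes n k F.
  have [/(exists_realization omega_alt omega_nondeg dimV n_gt0)[F FP]|kn] := leqP k n.
    by exists F.
  (* A dummy value: [F k] is used only for k at most n. *)
  by exists (fun=> 0).
pose F k := sval (cid (exF k)).
have FP k : (k <= n)%N -> realizes n k (F k) by rewrite /F; case: cid.
have exd k : exists d : {additive resolution_term omega n k.+1 -> resolution_term omega n k},
    equivariant d /\ ((k < n)%N -> forall x, F k (d x) = bd (F k.+1 x)).
  have [kn|nk] := ltnP k n.
    have [d [hd dE]] := exists_differential (FP k (ltnW kn)) (FP k.+1 kn).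
    by exists d.
  (* From position n on the differential is the zero map, equivariant because the action is
     additive. *)
  exists (\0 : {additive _ -> _}); split=> // g x /=.
  by have := gactD g 0 (0 : resolution_term omega n k); rewrite addr0 -[LHS]addr0 => /addrI.
pose d k := sval (cid (exd k)).
have d_equiv k : equivariant (d k) by rewrite /d; case: cid => ? [].
have dE k : (k < n)%N -> forall x, F k (d k x) = bd (F k.+1 x).
  by rewrite /d; case: cid => ? [].
have F0 k : (k <= n)%N -> F k 0 = 0.
  by case/FP=> FB _ _ _; have := FB 0 0; rewrite !subrr.
exists d; split=> // [k kn|k kn y|y].
- have k_lt : (k < n)%N by rewrite -kn.
  have [FB Finj _ RF] := FP _ k_lt.
  have ker0 x : d k x = 0 -> x = 0.
    move=> dx; apply: Finj; rewrite F0 //.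
    have hR : Rel omega n n (F k.+1 x) by rewrite -[X in Rel _ _ X]kn; apply/RF; exists x.
    by apply: (Rel_top_cycle omega_nondeg dimV n_gt0 hR); rewrite -dE // dx F0 // ltnW.
  by move=> x y exy; apply/eqP; rewrite -subr_eq0; apply/eqP/ker0; rewrite raddfB exy subrr.
- have k_lt := ltnW kn; have [_ Finj _ RF] := FP _ k_lt; have [_ Finj0 _ _] := FP _ (ltnW k_lt).
  have [_ _ _ RF2] := FP _ kn.
  split=> [dy|[x <-]]; last by apply: Finj0; rewrite dE // dE // bd_bd F0 // ltnW.
  have hR : Rel omega n k.+1 (F k.+1 y) by apply/RF; exists y.
  have [|b /RF2[x <-] bx] := Rel_exact omega_nondeg dimV n_gt0 hR.
    by rewrite -dE // dy F0 // ltnW.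
  by exists x; apply: Finj; rewrite dE.
have [_ Finj _ RF] := FP 0%N (leq0n n); have [_ _ _ RF1] := FP 1%N n_gt0.
have hR : Rel omega n 0 (F 0%N y) by apply/RF; exists y.
(* For k = 0 the boundary would need rank below 0, so a relative cycle is an absolute one,
   augmentation included. *)
have bd0 : bd (F 0%N y) = 0 by apply: supp_False; apply: suppW hR.2.
have [b /RF1[x <-] bx] := Rel_exact omega_nondeg dimV n_gt0 hR bd0.
by exists x; apply: Finj; rewrite dE.
Qed.
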